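(* There exists a smooth bounded domain $\Omega\subset\mathbb{C}^3$ with $0\in\partial\Omega$ such that: (1) There does not exist a hermitian metric in a neighborhood of the origin such that $\partial\Omega$ is $1$-pseudoconvex at the origin. (2) In the Euclidean metric, $\partial\Omega$ is weakly $Z(2)$.
   Context: Let $n=3$ and let $\rho$ be a smooth defining function of $\Omega$, i.e. $\Omega=\{\rho<0\}$ and $d\rho\ne0$ on $\partial\Omega$. For $z\in\partial\Omega$ let $T^{1,0}_z(\partial\Omega)=\{L\in T^{1,0}_z(\mathbb C^n):\partial\rho(L)=0\}$, and let $\mathcal L=\mathcal L_\rho$ be the Levi form, $\mathcal L(i\bar L\wedge L')=i\partial\bar\partial\rho(i\bar L\wedge L')$ for $L,L'\in T^{1,0}(\partial\Omega)$ (that is, $\mathcal L(i\bar L\wedge L')=\sum_{j,k}\frac{\partial^2\rho}{\partial z_j\partial\bar z_k}L'_j\bar L_k$). Its eigenvalues $\mu_1\le\cdots\le\mu_{n-1}$ are taken with respect to a given hermitian metric. $1$-pseudoconvexity: given a smooth hermitian metric in a neighborhood of a point $p\in\partial\Omega$, $\partial\Omega$ is $1$-pseudoconvex at $p$ if, in a neighborhood of $p$ in $\partial\Omega$, there is a smooth subbundle of $T^{1,0}(\partial\Omega)$ of rank at most $1$ such that the sum $\mu_1+\mu_2$ of the two smallest eigenvalues of the Levi form is greater than or equal to the trace of the Levi form with respect to this subbundle (so, when the rank is $0$, $\mu_1+\mu_2\ge0$; when the rank is $1$, $\mu_1+\mu_2\ge\mathcal L(i\bar u_1\wedge u_1)$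 with $u_1$ a unit section of the subbundle). Weak $Z(q)$ with respect to a Kähler metric with Kähler form $\omega$ (the Euclidean metric corresponds to $\omega=i\partial\bar\partial|z|^2$): a real $(1,1)$-vector $\Upsilon\in T^{1,1}(\partial\Omega)$ is written, in a local frame $L_1,\dots,L_{n-1}$ of $T^{1,0}(\partial\Omega)$, as $\Upsilon=i\sum_{j,k} b^{\bar kj}\bar L_k\wedge L_j$ with $(b^{\bar kj})$ hermitian (and here smooth), and a $(1,1)$-form $\eta=i\sum\eta_{j\bar k}\theta^j\wedge\bar\theta^k$ (dual coframe $\theta^j$) is paired with it by $\eta(\Upsilon)=\sum b^{\bar kj}\eta_{j\bar k}$. For $1\le q\le n-1$, $\partial\Omega$ is weakly $Z(q)$ if there is a real $\Upsilon\in T^{1,1}(\partial\Omega)$ such that: (i) $|\theta|^2\ge(i\theta\wedge\bar\theta)(\Upsilon)\ge0$ for all $(1,0)$-forms $\theta$ on $T^{1,0}(\partial\Omega)$; (ii) $\mu_1+\cdots+\mu_q-\mathcal L(\Upsilon)\ge0$ on $\partial\Omega$; (iii) $\omega(\Upsilon)\ne q$ at every point of $\partial\Omega$. *)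

(* Defs.v *)
From mathcomp Require Import all_boot all_order all_algebra.
From mathcomp Require Import all_classical all_reals all_analysis.
From mathcomp Require Import complex spectral.

Set Implicit Arguments.
Unset Strict Implicit.
Unset Printing Implicit Defensive.

Import Order.TTheory GRing.Theory Num.Theory.
Import numFieldNormedType.Exports.

Local Open Scope classical_set_scope.
Local Open Scope ring_scope.
Local Open Scope complex_scope.
Local Open Scope sesquilinear_scope.

(* C^n with its real structure: z = x + i y is the pair (x, y).
   Tangent vectors of type (1,0) at z, L = \sum_j L_j d/dz_j, are complex row
   vectors. *)
Notation Cn R n := ('rV[R]_n * 'rV[R]_n)%type.

Section Calculus.
Context {R : realType} {n : nat}.
Local Notation C := R[i].
Local Notation V := (Cn R n).

(* C^infinity on the open set U: all iterated directional derivatives are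
   differentiable at every point of U. *)
Definition smooth_on (U : set V) (f : V -> R) : Prop :=
  forall (s : seq V) (z : V), U z ->
    differentiable (foldr (fun v g => fun w => 'D_v g w) f s) z.

Definition smooth_mx_on (U : set V) (p q : nat) (M : V -> 'M[C]_(p, q)) : Prop :=
  forall i j, smooth_on U (fun z => complex.Re (M z i j)) /\
              smooth_on U (fun z => complex.Im (M z i j)).

(* Smoothness on a subset S which is not open, such as a hypersurface:
   local restriction of smooth functions of the ambient space. *)
Definition smooth_mx_along (S : set V) (p q : nat) (M : V -> 'M[C]_(p, q)) : Prop :=
  forall z0, S z0 -> exists (W : set V) (N : V -> 'M[C]_(p, q)),
    [/\ open W, W z0, smooth_mx_on W N & forall z, (W `&` S) z -> M z = N z].

Definition ex (j : 'I_n) : V := (delta_mx 0 j, 0).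
Definition ey (j : 'I_n) : V := (0, delta_mx 0 j).

Definition cderive (v : V) (f : V -> C) (z : V) : C :=
  'D_v (fun w => complex.Re (f w)) z +i* 'D_v (fun w => complex.Im (f w)) z.

Definition dz (j : 'I_n) (f : V -> C) (z : V) : C :=
  (cderive (ex j) f z - 'i%C * cderive (ey j) f z) / 2%:R.

Definition dzbar (j : 'I_n) (f : V -> C) (z : V) : C :=
  (cderive (ex j) f z + 'i%C * cderive (ey j) f z) / 2%:R.

End Calculus.

Section Domains.
Context {R : realType} {n : nat}.
Local Notation V := (Cn R n).

Definition boundary (Omega : set V) : set V := closure Omega `\` interior Omega.

Definition defining_function (Omega : set V) (rho : V -> R) : Prop :=
  [/\ smooth_on setT rho,
      Omega = [set z | rho z < 0] &
      forall z, boundary Omega z -> exists v, 'd rho z v != 0].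

Definition smooth_bounded_domain (Omega : set V) : Prop :=
  [/\ open Omega, connected Omega, Omega !=set0, bounded_set Omega &
      exists rho, defining_function Omega rho].

End Domains.

Section LeviGeometry.
Context {R : realType} {n : nat}.
Local Notation C := R[i].
Local Notation V := (Cn R n).

(* The row space of [T10 rho z] is {L | \sum_j (d rho / d z_j)(z) L_j = 0}. *)
Definition T10 (rho : V -> R) (z : V) : 'M[C]_n :=
  kermx (\col_(j < n) dz j (fun w => (rho w)%:C) z).

(* Matrix of the complex Hessian; the Levi form
   L(i \bar L /\ L') = \sum_{j,k} rho_{j \bar k} L'_j \bar L_k
   is the restriction of (L' *m levi_mx rho z *m L ^t* ) to T10. *)
Definition levi_mx (rho : V -> R) (z : V) : 'M[C]_n :=
  \matrix_(j, k) dz j (dzbar k (fun w => (rho w)%:C)) z.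

(* <L', L> = L' *m G z *m L ^t*; the associated (1,1)-form is
   \omega = i \sum_{j,k} (G z)_{jk} dz_j /\ d\bar z_k. *)
Definition hermitian_metric_on (W : set V) (G : V -> 'M[C]_n) : Prop :=
  smooth_mx_on W G /\
  forall z, W z -> G z \is hermsymmx /\
    forall L : 'rV[C]_n, L != 0 -> 0 < (L *m G z *m L ^t* ) 0 0.

(* The coefficient matrix of \omega = i d\bar d |z|^2. *)
Definition euclidean_metric : V -> 'M[C]_n := fun=> 1%:M.

(* Endomorphism (in a basis B of the row space of E) representing the hermitian
   form A restricted to E with respect to the metric G: u *m rel_mx = mu *: u
   iff u *m (B A B^* ) = mu *: u *m (B G B^* ).  Its eigenvalues and trace do
   not depend on B. *)
Definition rel_mx (m : nat) (G A : 'M[C]_n) (E : 'M[C]_(m, n)) : 'M[C]_(\rank E) :=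
  let B := row_base E in
  (B *m A *m B ^t* ) *m invmx (B *m G *m B ^t* ).

(* Nondecreasing list, with multiplicity, of the (real) roots of the
   characteristic polynomial. *)
Definition eigenvalues (m : nat) (M : 'M[C]_m) : seq R :=
  sort <=%R [seq complex.Re x | x <- sval (closed_field_poly_normal (char_poly M))].

Definition levi_eigenvalues (G : V -> 'M[C]_n) (rho : V -> R) (z : V) : seq R :=
  eigenvalues (rel_mx (G z) (levi_mx rho z) (T10 rho z)).

(* Trace of the Levi form with respect to the row space of E, i.e. the sum of
   L(i \bar u_a /\ u_a) over a G-orthonormal basis (u_a) of E. *)
Definition levi_trace (G : V -> 'M[C]_n) (rho : V -> R) (E : 'M[C]_n) (z : V) : R :=
  complex.Re (\tr (rel_mx (G z) (levi_mx rho z) E)).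

(* The row spaces of E form a smooth subbundle of rank r of T10 over S. *)
Definition smooth_subbundle (rho : V -> R) (S : set V) (r : nat)
    (E : V -> 'M[C]_n) : Prop :=
  forall z0, S z0 -> exists (W : set V) (B : V -> 'M[C]_(r, n)),
    [/\ open W, W z0, smooth_mx_on W B &
        forall z, (W `&` S) z ->
          [/\ row_free (B z), (B z :=: E z)%MS & (B z <= T10 rho z)%MS]].

(* W is a neighborhood of p on which the metric G is given. *)
Definition one_pseudoconvex_at (Omega : set V) (rho : V -> R)
    (W : set V) (G : V -> 'M[C]_n) (p : V) : Prop :=
  exists (U : set V) (r : nat) (E : V -> 'M[C]_n),
    [/\ open U /\ U p, U `<=` W, (r <= 1)%N,
        smooth_subbundle rho (U `&` boundary Omega) r E &
        forall z, (U `&` boundary Omega) z ->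
          levi_trace G rho (E z) z <= \sum_(i < 2) (levi_eigenvalues G rho z)`_i].

(* Upsilon = i \sum_{j,k} b^{\bar k j} \bar L_k /\ L_j is encoded by its
   coefficients in d/d\bar z_k /\ d/dz_j: in a local frame of T10 with matrix
   B, (Upsilon z)_{kj} = (B^* b B)_{kj}, so that b is hermitian (smooth) iff
   Upsilon z is, and Upsilon z is tangential iff its rows lie in T10. *)
Definition real_tangential_11_vector (Omega : set V) (rho : V -> R)
    (Upsilon : V -> 'M[C]_n) : Prop :=
  smooth_mx_along (boundary Omega) Upsilon /\
  forall z, boundary Omega z ->
    Upsilon z \is hermsymmx /\ (Upsilon z <= T10 rho z)%MS.

(* \eta(Upsilon) = \sum_{j,k} Upsilon^{\bar k j} \eta_{j \bar k} for
   \eta = i \sum_{j,k} \eta_{j \bar k} dz_j /\ d\bar z_k. *)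
Definition pairing (eta Ups : 'M[C]_n) : C := \sum_j \sum_k Ups k j * eta j k.

(* i \theta /\ \bar\theta for \theta = \sum_j \theta_j dz_j. *)
Definition theta_form (theta : 'cV[C]_n) : 'M[C]_n := theta *m theta ^t*.

(* |\theta|^2 in the metric dual to G on the row space of E: B *m theta lists
   the values of \theta on the basis B, whose Gram matrix is B G B^*. *)
Definition dual_norm2 (m : nat) (G : 'M[C]_n) (E : 'M[C]_(m, n)) (theta : 'cV[C]_n) : C :=
  let B := row_base E in
  ((B *m theta) ^t* *m invmx (B *m G *m B ^t* ) *m (B *m theta)) 0 0.

Definition weakly_Z (q : nat) (Omega : set V) (rho : V -> R)
    (G : V -> 'M[C]_n) : Prop :=
  (1 <= q <= n.-1)%N /\
  exists Upsilon : V -> 'M[C]_n,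
    real_tangential_11_vector Omega rho Upsilon /\
    forall z, boundary Omega z ->
      [/\ forall theta : 'cV[C]_n,
            0 <= pairing (theta_form theta) (Upsilon z)
              <= dual_norm2 (G z) (T10 rho z) theta,
          0 <= \sum_(i < q) (levi_eigenvalues G rho z)`_i
               - complex.Re (pairing (levi_mx rho z) (Upsilon z)) &
          pairing (G z) (Upsilon z) != q%:R].

End LeviGeometry.

Arguments euclidean_metric {R n}.

(* Main.v *)
Require Import Defs.
From HB Require Import structures.
From mathcomp Require Import all_boot all_order all_algebra.
From mathcomp Require Import all_classical all_reals all_analysis.
From mathcomp Require Import complex spectral.
From mathcomp Require Import ring lra.
Import Order.TTheory GRing.Theory Num.Theory.
Import numFieldNormedType.Exports.
Local Open Scope classical_set_scope.
Local Open Scope ring_scope.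
Set Implicit Arguments.
Unset Strict Implicit.
Unset Printing Implicit Defensive.

(** The domain is the Hartogs domain |w - i|^2 + F(z1, z2) < 1 in C^3 with

      F = 2 x^3 - 3 x a (a + y^2) + b^2 + (a + b)^3,
      a = |z1|^2,  b = |z2|^2,  z2 = x + i y.

    In C^3 the sum mu_1 + mu_2 is the whole trace of the Levi form L on the
    2-dimensional space T of (1,0) tangent vectors, so both notions ask for a
    smooth positive semidefinite tangential Phi with L(Phi) >= 0.  Writing
    Upsilon = P - Phi, with P the orthogonal projector on T, weak Z(2) accepts
    every nowhere zero Phi.  1-pseudoconvexity at 0 asks, near 0, for a Phi of
    constant rank: positive definite (the inverse of the metric) if the
    subbundle has rank 0, and v^* v with v spanning the orthogonal complement
    of the subbundle in T if it has rank 1.  So F must be such that every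
    admissible Phi has rank 1 at 0 and rank 2 at some points near 0.

    Tangent vectors are lifted from (z1, z2)-space: along the lifts of d/dz1 and
    d/dz2 the Levi form is the complex Hessian of F plus a square, up to a
    positive factor.  There
    F_{2 2bar} = 3x + O(2) changes sign, while
    F_{1 1bar} = - 3x (4a + y^2) + O(4).  Put psi = 4a + y^2 + b^2, a function
    which vanishes only at the origin.  The terms of higher order in F make
    F_{1 1bar} + psi F_{2 2bar} >= 0 on the whole of C^2
    ([weighted_levi_ge0]), so that diag (1, psi), lifted to T, is the wanted Phi;
    this gives [weakly_Z_Omega0].

    The first order term 3x of F_{2 2bar} excludes a positive definite Phi
    ([no_nonneg_levi_trace]).  Let v be a differentiable vector field with
    L(v, v) >= 0.  At first order L(v, v) is 3x |v_2(0)|^2, so v_2(0) = 0.  Let l be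
    the real differential of v_2 at 0.  At third order L(v, v) is
    3x (|l|^2 - (4a + y^2) |v_1(0)|^2), an odd function of the point, hence zero:
    |l|^2 = (4a + y^2) |v_1(0)|^2.  The right-hand side has real rank 3 as soon as
    v_1(0) <> 0, whereas l takes its values in the plane C, so v(0) = 0
    ([no_differentiable_nonneg_line]).

    The domain is bounded since the sextic term of F dominates, and connected
    since the weighted dilations (t z1, t^2 z2, i + t^3 (w - i)), 0 <= t <= 1,
    preserve it ([dilate_Omega0]).  Everything is stated for an arbitrary
    defining function; on the boundary two of them have proportional
    differentials, and proportional second derivatives along tangent vectors
    ([defining_functions_proportional]). *)

(** * Smooth functions *)
Section Smooth.
Context {R : realType} {n : nat}.
Local Notation V := (Cn R n).
Local Notation smooth := (@smooth_on R n setT).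
Implicit Types (f g : V -> R) (v z : V).

Lemma smooth_derive f v : smooth f -> smooth ('D_v f).
Proof. by move=> sf s z Uz; have := sf (rcons s v) z Uz; rewrite foldr_rcons. Qed.

Lemma smooth_differentiable f z : smooth f -> differentiable f z.
Proof. by move=> sf; apply: (sf [::]). Qed.

Lemma smooth_derivable f z v : smooth f -> derivable f z v.
Proof. by move=> sf; apply/diff_derivable/smooth_differentiable. Qed.

(** The derivative of a product is a sum of two products, so stability under
    products and inverses is proved by induction on the order of
    differentiability, for all functions at once, rather than on the list of
    directions of [smooth_on]. *)
Fixpoint Ck (k : nat) f : Prop :=
  (forall z, differentiable f z) /\
  if k is k'.+1 then forall v, Ck k' ('D_v f) else True.

Lemma smoothP f : smooth f <-> forall k, Ck k f.
Proof.
split=> [sf k|Cf s z Uz].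
  elim: k f sf => [|k IHk] f sf /=; split=> //.
  - by move=> z; apply: smooth_differentiable.
  - by move=> z; apply: smooth_differentiable.
  - by move=> v; apply/IHk/smooth_derive.
have : Ck (size s) f by [].
elim/last_ind: s f {Cf} => [|s v IHs] f /=; first by move=> [+ _]; apply.
by rewrite size_rcons => -[_ /(_ v)] Cf; rewrite foldr_rcons; apply: IHs.
Qed.

Lemma Ck_diff k f z : Ck k f -> differentiable f z.
Proof. by case: k => [|k] [+ _]; apply. Qed.

Lemma Ck_derivable k f z v : Ck k f -> derivable f z v.
Proof. by move=> /Ck_diff df; apply: diff_derivable. Qed.

Lemma CkW k f : Ck k.+1 f -> Ck k f.
Proof.
elim: k f => [|k IHk] f [df Df]; split=> // v.
by apply: IHk; apply: Df.
Qed.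

Lemma Ck_cst k c : Ck k (fun=> c).
Proof.
elim: k c => [|k IHk] c; split=> //; try by move=> z; apply: (differentiable_cst c).
move=> v.
have -> : 'D_v (fun=> c : R) = fun=> 0; last exact: IHk.
by apply/funext => z; rewrite derive_cst.
Qed.

Lemma Ck_add k f g : Ck k f -> Ck k g -> Ck k (fun z => f z + g z).
Proof.
elim: k f g => [|k IHk] f g Cf Cg; split=> //;
  try by move=> z; apply: differentiableD; [apply: Ck_diff Cf|apply: Ck_diff Cg].
move=> v.
have -> : 'D_v (fun z => f z + g z) = fun z => 'D_v f z + 'D_v g z.
  by apply/funext => z; rewrite deriveD//; [apply: Ck_derivable Cf|apply: Ck_derivable Cg].
by case: Cf => _ Cf; case: Cg => _ Cg; apply: IHk; [exact: Cf|exact: Cg].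
Qed.

Lemma Ck_mul k f g : Ck k f -> Ck k g -> Ck k (fun z => f z * g z).
Proof.
elim: k f g => [|k IHk] f g Cf Cg; split=> //;
  try by move=> z; apply: differentiableM; [apply: Ck_diff Cf|apply: Ck_diff Cg].
move=> v.
have -> : 'D_v (fun z => f z * g z) = fun z => f z * 'D_v g z + g z * 'D_v f z.
  by apply/funext => z; rewrite deriveM//; [apply: Ck_derivable Cf|apply: Ck_derivable Cg].
by apply: Ck_add; apply: IHk; [exact: CkW|case: Cg => _; apply|exact: CkW|case: Cf => _; apply].
Qed.

Lemma Ck_inv k f : (forall z, f z != 0) -> Ck k f -> Ck k (fun z => (f z)^-1).
Proof.
move=> f0; elim: k f f0 => [|k IHk] f f0 Cf; split=> //;
  try by move=> z; apply: differentiableV; [apply: Ck_diff Cf|].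
move=> v.
have -> : 'D_v (fun z => (f z)^-1) = fun z => -1 * ((f z)^-1 * (f z)^-1) * 'D_v f z.
  apply/funext => z; rewrite deriveV//; last exact: Ck_derivable Cf.
  by rewrite mulN1r -invfM -expr2.
apply: Ck_mul; last by case: Cf => _; apply.
by apply: Ck_mul; [exact: Ck_cst|apply: Ck_mul; apply: IHk => //; apply: CkW].
Qed.

Lemma smooth_cst c : smooth (fun=> c).
Proof. by apply/smoothP => k; apply: Ck_cst. Qed.

Lemma smooth_add f g : smooth f -> smooth g -> smooth (fun z => f z + g z).
Proof. by move=> /smoothP sf /smoothP sg; apply/smoothP => k; apply: Ck_add. Qed.

Lemma smooth_mul f g : smooth f -> smooth g -> smooth (fun z => f z * g z).
Proof. by move=> /smoothP sf /smoothP sg; apply/smoothP => k; apply: Ck_mul. Qed.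

Lemma smooth_opp f : smooth f -> smooth (fun z => - f z).
Proof.
move=> sf; have -> : (fun z => - f z) = (fun z => -1 * f z).
  by apply/funext => z; rewrite mulN1r.
by apply: smooth_mul => //; apply: smooth_cst.
Qed.

Lemma smooth_exp f k : smooth f -> smooth (fun z => f z ^+ k).
Proof.
move=> sf; elim: k => [|k IHk]; first exact: smooth_cst.
by under eq_fun do rewrite exprS; apply: smooth_mul.
Qed.

Lemma smooth_inv f : (forall z, f z != 0) -> smooth f ->
  smooth (fun z => (f z)^-1).
Proof. by move=> f0 /smoothP sf; apply/smoothP => k; apply: Ck_inv. Qed.

Definition re_coord (j : 'I_n) z : R := z.1 0 j.
Definition im_coord (j : 'I_n) z : R := z.2 0 j.

Lemma is_diff_linear_coord (f : {linear V -> R}) z : continuous f -> is_diff z f f.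
Proof.
move=> cf; apply: DiffDef; first exact: linear_differentiable.
exact: diff_lin.
Qed.

Lemma is_diff_re_coord j z : is_diff z (re_coord j) (re_coord j).
Proof.
have lin : linear (re_coord j) by move=> k u v; rewrite /re_coord !mxE.
pose L : {linear V -> R} := HB.pack (re_coord j) (GRing.isLinear.Build _ _ _ _ _ lin).
apply: (@is_diff_linear_coord L) => w.
by apply: (@continuous_comp _ _ _ fst (fun M : 'rV[R]_n => M 0 j));
  [exact: cvg_fst|exact: coord_continuous].
Qed.

Lemma is_diff_im_coord j z : is_diff z (im_coord j) (im_coord j).
Proof.
have lin : linear (im_coord j) by move=> k u v; rewrite /im_coord !mxE.
pose L : {linear V -> R} := HB.pack (im_coord j) (GRing.isLinear.Build _ _ _ _ _ lin).
apply: (@is_diff_linear_coord L) => w.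
by apply: (@continuous_comp _ _ _ snd (fun M : 'rV[R]_n => M 0 j));
  [exact: cvg_snd|exact: coord_continuous].
Qed.

Lemma is_derive_re_coord j z v : is_derive z v (re_coord j) (re_coord j v).
Proof.
have := is_diff_re_coord j z => d; apply: DeriveDef; first exact: diff_derivable.
by rewrite deriveE// diff_val.
Qed.

Lemma is_derive_im_coord j z v : is_derive z v (im_coord j) (im_coord j v).
Proof.
have := is_diff_im_coord j z => d; apply: DeriveDef; first exact: diff_derivable.
by rewrite deriveE// diff_val.
Qed.

Lemma smooth_re_coord j : smooth (re_coord j).
Proof.
apply/smoothP => -[|k]; split=> //; try by move=> z; have [] := is_diff_re_coord j z.
move=> v; have -> : 'D_v (re_coord j) = fun=> re_coord j v; last exact: Ck_cst.
by apply/funext => z; have [] := is_derive_re_coord j z v.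
Qed.

Lemma smooth_im_coord j : smooth (im_coord j).
Proof.
apply/smoothP => -[|k]; split=> //; try by move=> z; have [] := is_diff_im_coord j z.
move=> v; have -> : 'D_v (im_coord j) = fun=> im_coord j v; last exact: Ck_cst.
by apply/funext => z; have [] := is_derive_im_coord j z v.
Qed.

End Smooth.

Ltac smooth_poly :=
  repeat first [ exact: smooth_cst | exact: smooth_re_coord | exact: smooth_im_coord
  | apply: smooth_exp | apply: smooth_opp | apply: smooth_add | apply: smooth_mul ].

(** * Dependence on the defining function *)
Section TestCurves.
Context {R : realType} {n : nat}.
Local Notation V := (Cn R n).
Local Notation smooth := (@smooth_on R n setT).
Implicit Types (f rho : V -> R) (u v w z : V).

Lemma is_derive_comp_curve f (c : R -> V) t v :
  differentiable f (c t) -> is_derive t 1 c v ->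
  is_derive t 1 (f \o c) ('d f (c t) v).
Proof.
move=> df [dc <-]; have dc' : differentiable c t by apply/derivable1_diffP.
have dfc : differentiable (f \o c) t by exact: differentiable_comp.
apply: DeriveDef; first exact: diff_derivable.
by rewrite deriveE// diff_comp//= deriveE.
Qed.

Lemma deriveDl f u v z : differentiable f z ->
  'D_(u + v) f z = 'D_u f z + 'D_v f z.
Proof. by move=> df; rewrite !deriveE// linearD. Qed.

Lemma deriveZl f k v z : differentiable f z -> 'D_(k *: v) f z = k * 'D_v f z.
Proof. by move=> df; rewrite !deriveE// linearZ. Qed.

Lemma deriveNl f v z : differentiable f z -> 'D_(- v) f z = - 'D_v f z.
Proof. by move=> df; rewrite !deriveE// linearN. Qed.

Lemma is_derive_scalel (k : R -> R) v (t dk : R) : is_derive t 1 k dk ->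
  is_derive t 1 (fun s => k s *: v) (dk *: v).
Proof.
move=> [dk1 <-]; have dk2 : differentiable k t by apply/derivable1_diffP.
have dw : differentiable (fun s : R => k s *: v) t by exact: differentiableZl.
apply: DeriveDef; first exact: diff_derivable.
by rewrite deriveE// diffZl//= -deriveE.
Qed.

Lemma is_derive_scaled v (t : R) : is_derive t 1 (fun s : R => s *: v) v.
Proof.
apply: DeriveDef; first exact: diff_derivable.
by rewrite deriveE// diff_val scale1r.
Qed.

Lemma cvg_quotient_right (g : R -> R) d : is_derive (0 : R) 1 g d ->
  (fun h => h^-1 * (g h - g 0)) @ (0 : R)^'+ --> d.
Proof.
move=> [dg ed]; apply: cvg_dnbhs_at_right; rewrite -ed.
have -> : (fun h => h^-1 * (g h - g 0)) =
    (fun h => h^-1 *: ((g \o shift 0) (h *: (1 : R)) - g 0)).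
  by apply/funext => h /=; rewrite addr0 [h *: 1]mulr1.
exact: dg.
Qed.

Lemma derivative_lt0_right (g : R -> R) d :
  g 0 = 0 -> is_derive (0 : R) 1 g d -> d < 0 -> \forall t \near 0^'+, g t < 0.
Proof.
move=> g0 /cvg_quotient_right cg d0.
have lt0 : \forall t \near (0 : R)^'+, t^-1 * (g t - g 0) < 0.
  by apply: (cvgr_lt d).
near=> t.
have t0 : 0 < t by near: t; exact: nbhs_right_gt.
have : t^-1 * (g t - g 0) < 0 by near: t.
by rewrite g0 subr0 pmulr_rlt0// invr_gt0.
Unshelve. all: by end_near. Qed.

Definition parabola z v w (t : R) : V := z + (t *: v + t ^+ 2 *: w).

Lemma is_derive_parabola z v w (t : R) :
  is_derive t 1 (parabola z v w) (v + (2 * t) *: w).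
Proof.
have d1 := is_derive_scaled v t.
have d2 : is_derive t 1 (fun s : R => s ^+ 2 *: w) ((2 * t) *: w).
  apply: is_derive_scalel.
  by apply: is_derive_eq; rewrite [t%:A]mulr1; ring.
have -> : parabola z v w = cst z + ((fun s => s *: v) + (fun s => s ^+ 2 *: w)).
  by [].
by have := is_deriveD (is_derive_cst z t (1 : R)) (is_deriveD d1 d2); rewrite add0r.
Qed.

Lemma parabola0 z v w : parabola z v w 0 = z.
Proof. by rewrite /parabola scale0r expr0n scale0r !addr0. Qed.

Lemma line_lt0 f z v : smooth f -> f z = 0 -> 'D_v f z < 0 ->
  \forall t \near 0^'+, f (z + t *: v) < 0.
Proof.
move=> sf f0 dv; have := is_derive_parabola z v 0 0.
rewrite scaler0 addr0 => dp.
have dfp := is_derive_comp_curve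
  (smooth_differentiable (parabola z v 0 0) sf) dp.
rewrite parabola0 -deriveE in dfp; last exact: smooth_differentiable.
have := derivative_lt0_right _ dfp dv; rewrite /= parabola0 => /(_ f0).
by apply: filterS => t; rewrite /parabola scaler0 addr0.
Qed.

(** The second derivative at 0 of f along z + t v + t^2 w is
    D_v D_v f + 2 D_w f: choosing w shifts it by any amount, so the signs of f on
    these parabolas determine D_v D_v f. *)
Lemma parabola_lt0 f z v w : smooth f -> f z = 0 -> 'D_v f z = 0 ->
  'D_v ('D_v f) z + 2 * 'D_w f z < 0 ->
  \forall t \near 0^'+, f (parabola z v w t) < 0.
Proof.
move=> sf f0 dv0 d2.
pose c := parabola z v w.
pose g' (t : R) := 'D_v f (c t) + (2 * t) * 'D_w f (c t).
have dg (t : R) : is_derive t 1 (f \o c) (g' t).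
  have := is_derive_comp_curve (smooth_differentiable (c t) sf) (is_derive_parabola z v w t).
  have dc := smooth_differentiable (c t) sf.
  by rewrite -deriveE// deriveDl// deriveZl.
have dcomp u : is_derive (0 : R) 1 ('D_u f \o c) ('D_v ('D_u f) z).
  have sDu := smooth_derive u sf.
  have := is_derive_comp_curve (smooth_differentiable (c 0) sDu) (is_derive_parabola z v w 0).
  by rewrite mulr0 scale0r addr0 /c parabola0 -deriveE//; apply: smooth_differentiable.
have dg' : is_derive (0 : R) 1 g' ('D_v ('D_v f) z + 2 * 'D_w f z).
  have -> : g' = ('D_v f \o c) + (2 \*o id) * ('D_w f \o c) by [].
  have d1 := dcomp v; have d3 := dcomp w.
  have d2' : is_derive (0 : R) 1 (2 \*o id : R -> R) 2.
    apply: DeriveDef; first by apply: derivableM.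
    by rewrite deriveMl// derive_id mulr1.
  have := is_deriveD d1 (is_deriveM d2' d3) => /=.
  by rewrite mulr0 scale0r add0r /c parabola0 [_ *: (2 : R)]mulrC.
have g'0 : g' 0 = 0 by rewrite /g' /c parabola0 dv0 mulr0 mul0r addr0.
have [d /= d0 hd] := derivative_lt0_right g'0 dg' d2.
exists d => //= t /= td t0.
have cont : {within `[0, t], continuous (f \o c)}.
  apply: continuous_subspaceT => x.
  by apply/differentiable_continuous/derivable1_diffP; have [] := dg x.
(* f at time t is t g'(x) for some 0 < x < t, and g' is negative there *)
have [x] := MVT t0 (fun x _ => dg x) cont.
rewrite in_itv /= => /andP[x0 xt].
rewrite /= {2}/c parabola0 f0 !subr0 => ->.
rewrite pmulr_llt0//; apply: hd => //=.
move: td; rewrite !sub0r !normrN !gtr0_norm//; exact: lt_trans.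
Qed.

Lemma smooth_continuous f : smooth f -> continuous f.
Proof. by move=> sf z; apply/differentiable_continuous/smooth_differentiable. Qed.

Lemma defining_function_open (Omega : set V) rho :
  defining_function Omega rho -> open Omega.
Proof.
move=> [/smooth_continuous cr -> _].
by apply: (@open_comp _ _ rho [set x | x < 0]) => [z _|]; [exact: cr|exact: open_lt].
Qed.

Lemma boundary_eq0 (Omega : set V) rho z : smooth rho ->
  Omega = [set x | rho x < 0] -> boundary Omega z -> rho z = 0.
Proof.
move=> /smooth_continuous cr -> [clz niz].
apply/eqP; rewrite eq_le !leNgt; apply/andP; split; apply/negP => rz.
  have : nbhs z [set x | 0 < rho x] by apply: (cvgr_gt _ (cr z)).
  by move=> /clz[x [+ /= x0]] => /(lt_trans x0); rewrite ltxx.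
by apply: niz; apply: (cvgr_lt _ (cr z)).
Qed.

Lemma exists_derive_lt0 f z v : differentiable f z -> 'D_v f z != 0 ->
  exists w, 'D_w f z < 0.
Proof.
move=> df; rewrite neq_lt => /orP[?|?]; first by exists v.
by exists (- v); rewrite deriveNl// oppr_lt0.
Qed.

(** A zero at which the differential does not vanish is a limit of points of
    the domain: follow a line on which rho decreases. *)
Lemma eq0_boundary (Omega : set V) rho z v : smooth rho ->
  Omega = [set x | rho x < 0] -> rho z = 0 -> 'D_v rho z != 0 ->
  boundary Omega z.
Proof.
move=> sr EO rz dv.
have [w dw] := exists_derive_lt0 (smooth_differentiable z sr) dv.
split; last first.
  by move=> /interior_subset; rewrite EO /= rz ltxx.
move=> B Bz.
have cl : (fun t : R => z + t *: w) @ 0^'+ --> z.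
  apply: cvg_at_right_filter.
  suff : (fun t : R => z + t *: w) @ (0 : R) --> z + (0 : R) *: w.
    by rewrite scale0r addr0.
  by apply: cvgD; [exact: cvg_cst|apply: cvgZr_tmp; exact: cvg_id].
have near_lt := line_lt0 sr rz dw.
have near_B := cl B Bz.
near (0 : R)^'+ => t; exists (z + t *: w); split; last by near: t.
by rewrite EO /=; near: t.
Unshelve. all: by end_near. Qed.

(** Otherwise some parabola would carry points with f < 0 and g > 0. *)
Lemma same_sign_second_order (f g : V -> R) z v w : smooth f -> smooth g ->
  (forall x, f x < 0 -> g x < 0) -> f z = 0 -> g z = 0 ->
  'D_v f z = 0 -> 'D_v g z = 0 ->
  'D_v ('D_v f) z + 2 * 'D_w f z < 0 -> 'D_v ('D_v g) z + 2 * 'D_w g z <= 0.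
Proof.
move=> sf sg fg f0 g0 dvf dvg df; rewrite leNgt; apply/negP => dg.
have sNg := smooth_opp sg.
have DNg u x : 'D_u (fun x => - g x) x = - 'D_u g x.
  by rewrite deriveN//; apply: smooth_derivable.
have : 'D_v ('D_v (fun x => - g x)) z + 2 * 'D_w (fun x => - g x) z < 0.
  rewrite (_ : 'D_v (fun x => - g x) = fun x => - 'D_v g x); last first.
    by apply/funext => x; exact: DNg.
  rewrite DNg deriveN; last exact/smooth_derivable/smooth_derive.
  by rewrite mulrN -opprD oppr_lt0.
move=> /(parabola_lt0 sNg); rewrite g0 oppr0 DNg dvg oppr0 => /(_ erefl erefl) ng.
have nf := parabola_lt0 sf f0 dvf df.
near (0 : R)^'+ => t.
have h1 : - g (parabola z v w t) < 0 by near: t.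
have h2 : f (parabola z v w t) < 0 by near: t.
by move: h1; rewrite oppr_lt0 => /(lt_trans (fg _ h2)); rewrite ltxx.
Unshelve. all: by end_near. Qed.

Lemma scalar_linearZ (l : {linear V -> R}) k v : l (k *: v) = k * l v.
Proof. exact: linearZ. Qed.

(** The half-space where l0 is negative lies in the one where l is nonpositive,
    so the kernel of l0 lies in that of l. *)
Lemma proportional_linear (l0 l : {linear V -> R}) a b :
  (forall v, l0 v < 0 -> l v <= 0) -> l0 a != 0 -> l b != 0 ->
  exists2 h, 0 < h & forall v, l v = h * l0 v.
Proof.
move=> sgn.
have pos (g : {linear V -> R}) v : g v != 0 -> exists2 w, g w < 0 & g w != 0.
  rewrite neq_lt => /orP[g0|g0]; first by exists v; rewrite ?lt_eqF.
  by exists (- v); rewrite linearN ?oppr_lt0// oppr_eq0 gt_eqF.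
move=> /pos[w w0 wn0] /pos[b' b'0 _].
have ker v : l0 v = 0 -> l v = 0.
  move=> v0; apply/eqP/negPn/negP => v1.
  (* moving from w along the kernel of l0 would bring l up to the value 1 *)
  have : l (w + ((1 - l w) / l v) *: v) <= 0.
    by apply: sgn; rewrite linearD scalar_linearZ v0 mulr0 addr0.
  by rewrite linearD scalar_linearZ divfK// addrC subrK ler10.
have lE v : l v = l w / l0 w * l0 v.
  have := ker (v - (l0 v / l0 w) *: w).
  rewrite !linearB !scalar_linearZ divfK// subrr => /(_ erefl)/subr0_eq ->.
  by rewrite [LHS]mulrAC [RHS]mulrAC [l0 v * _]mulrC.
exists (l w / l0 w) => //.
have lw : l w <= 0 by exact: sgn.
rewrite nmulr_lgt0 ?invr_lt0// lt_neqAle lw andbT.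
by apply: contraTneq b'0 => lw0; rewrite lE lw0 !mul0r ltxx.
Qed.

Lemma affine_sign (A0 A1 h : R) : 0 < h ->
  (forall c, A0 + c < 0 -> A1 + h * c <= 0) ->
  (forall c, A1 + h * c < 0 -> A0 + c <= 0) -> A1 = h * A0.
Proof.
move=> h0 t01 t10; have [lt|gt|//] := ltgtP A1 (h * A0).
- have he : h * ((h * A0 - A1) / 2 / h) = (h * A0 - A1) / 2.
    by rewrite mulrC divfK// gt_eqF.
  have e0 : 0 < (h * A0 - A1) / 2 / h by rewrite !divr_gt0// subr_gt0.
  by have := t10 (- A0 + (h * A0 - A1) / 2 / h); rewrite mulrDr he mulrN; lra.
- have he : h * ((A1 - h * A0) / 2 / h) = (A1 - h * A0) / 2.
    by rewrite mulrC divfK// gt_eqF.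
  have e0 : 0 < (A1 - h * A0) / 2 / h by rewrite !divr_gt0// subr_gt0.
  by have := t01 (- A0 - (A1 - h * A0) / 2 / h); rewrite mulrBr he mulrN; lra.
Qed.

(** The signs of rho and rho0 agree on all lines and parabolas through z, and
    these signs determine the derivatives up to a common positive factor. *)
Lemma defining_functions_proportional (Omega : set V) rho0 rho z :
  defining_function Omega rho0 -> defining_function Omega rho ->
  boundary Omega z ->
  exists2 h, 0 < h & (forall v, 'D_v rho z = h * 'D_v rho0 z) /\
    forall v, 'D_v rho0 z = 0 -> 'D_v ('D_v rho) z = h * 'D_v ('D_v rho0) z.
Proof.
move=> D0 D1 bz; have [s0 E0 r0] := D0; have [s1 E1 r1] := D1.
have z0 := boundary_eq0 s0 E0 bz; have z1 := boundary_eq0 s1 E1 bz.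
have df0 := smooth_differentiable z s0; have df1 := smooth_differentiable z s1.
have lt01 x : rho0 x < 0 -> rho x < 0.
  by move=> lt; suff : [set y | rho y < 0] x by []; rewrite -E1 E0.
have lt10 x : rho x < 0 -> rho0 x < 0.
  by move=> lt; suff : [set y | rho0 y < 0] x by []; rewrite -E0 E1.
have [a a0] := r0 z bz; have [b b0] := r1 z bz.
have [|h h0 first] := proportional_linear _ a0 b0.
  move=> v dv; have := @same_sign_second_order rho0 rho z 0 v s0 s1 lt01 z0 z1.
  rewrite !derive0 !add0r (deriveE v df0) (deriveE v df1) => /(_ erefl erefl).
  by rewrite (pmulr_rlt0 _ (ltr0Sn R 1)) (pmulr_rle0 _ (ltr0Sn R 1)); apply.
exists h => //; split=> [v|v v0]; first by rewrite !deriveE.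
have v1 : 'D_v rho z = 0 by rewrite deriveE// first -deriveE// v0 mulr0.
have half (l : {linear V -> R}) : l a != 0 -> forall c, exists w, 2 * l w = c.
  move=> la c; exists ((c / 2 / l a) *: a).
  by rewrite scalar_linearZ divfK// mulrC divfK.
apply: affine_sign => // c.
- have [w wc] := half _ a0 c.
  have := @same_sign_second_order rho0 rho z v w s0 s1 lt01 z0 z1 v0 v1.
  by rewrite (deriveE w df0) (deriveE w df1) first mulrCA wc; apply.
- have [w wc] := half _ a0 c.
  have := @same_sign_second_order rho rho0 z v w s1 s0 lt10 z1 z0 v1 v0.
  by rewrite (deriveE w df0) (deriveE w df1) first mulrCA wc; apply.
Qed.

End TestCurves.

(** * Traces of hermitian forms relative to a metric *)
Section RelativeTrace.
Context {R : realType} {n : nat}.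
Local Notation C := R[i].
Local Open Scope complex_scope.
Local Open Scope sesquilinear_scope.

Lemma adjmxM m p q (A : 'M[C]_(m, p)) (B : 'M[C]_(p, q)) :
  (A *m B) ^t* = B ^t* *m A ^t*.
Proof. by rewrite trmx_mul map_mxM. Qed.

Lemma adjmxK m p (A : 'M[C]_(m, p)) : A ^t* ^t* = A.
Proof. by apply/matrixP => i j; rewrite !mxE conjCK. Qed.

Lemma hermsymmxP m (A : 'M[C]_m) : A \is hermsymmx <-> A = A ^t*.
Proof.
split=> [/is_hermitianmxP|AE]; first by rewrite expr0 scale1r.
by apply/is_hermitianmxP; rewrite expr0 scale1r.
Qed.

Lemma sum_eigenvalues m (M : 'M[C]_m) :
  size (eigenvalues M) = m /\ \sum_(x <- eigenvalues M) x = complex.Re (\tr M).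
Proof.
rewrite /eigenvalues; case: closed_field_poly_normal => s /=.
rewrite (monicP (char_poly_monic M)) scale1r => Ms.
have ss : size s = m.
  by have := size_char_poly M; rewrite Ms size_prod_XsubC => -[].
split; first by rewrite size_sort size_map.
rewrite (perm_big [seq complex.Re x | x <- s]) /=; last first.
  by rewrite perm_sort perm_refl.
rewrite big_map -(raddf_sum (@complex.Re R : Rcomplex R -> R)).
congr complex.Re; case: m => [|m] in M Ms ss *.
  by rewrite (size0nil ss) big_nil /mxtrace big_ord0.
have := @coefPn_prod_XsubC _ s; rewrite ss /= => /(_ isT) cs.
by apply: oppr_inj; rewrite -char_poly_trace// Ms cs.
Qed.

Lemma sum_eigenvalues2 m (M : 'M[C]_m) : m = 2%N ->
  \sum_(i < 2) (eigenvalues M)`_i = complex.Re (\tr M).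
Proof.
have [sz <-] := sum_eigenvalues M; move=> m2.
by rewrite [RHS](big_nth 0) (etrans sz m2) big_mkord.
Qed.

Definition posdef (G : 'M[C]_n) :=
  G \is hermsymmx /\ forall L : 'rV[C]_n, L != 0 -> 0 < (L *m G *m L ^t* ) 0 0.

Lemma gram_unit (G : 'M[C]_n) m (B : 'M[C]_(m, n)) : posdef G -> row_free B ->
  B *m G *m B ^t* \in unitmx.
Proof.
move=> [_ Gpos] fB; rewrite -row_free_unit -kermx_eq0; apply/negPn/negP => k0.
have [u uker u0] := rowV0Pn k0.
have uB0 : u *m B != 0 by rewrite mulmx_free_eq0.
have := Gpos _ uB0; rewrite adjmxM !mulmxA -2!mulmxA.
move/sub_kermxP: uker; rewrite !mulmxA => ->.
by rewrite mul0mx mxE ltxx.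
Qed.

(** A change of basis X, with inverse Y, turns the quotient of the two Gram
    matrices M N^-1 into X M N^-1 Y, which has the same trace. *)
Lemma mxtrace_rel_mx (G A : 'M[C]_n) m r (E : 'M[C]_(m, n)) (B : 'M[C]_(r, n)) :
  posdef G -> row_free B -> (B :=: E)%MS ->
  \tr (rel_mx G A E) =
  \tr ((B *m A *m B ^t* ) *m invmx (B *m G *m B ^t* )).
Proof.
move=> Gpos fB BE; rewrite /rel_mx; set B0 := row_base E.
have fB0 : row_free B0 by exact: row_base_free.
have /submxP[X BX] : (B <= B0)%MS by rewrite BE eq_row_base.
have /submxP[Y B0Y] : (B0 <= B)%MS by rewrite BE eq_row_base.
have XY : X *m Y = 1%:M.
  by apply: (row_free_inj fB); rewrite mul1mx -mulmxA -B0Y -BX.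
have YX : Y *m X = 1%:M.
  by apply: (row_free_inj fB0); rewrite mul1mx -mulmxA -BX -B0Y.
have XYs : X ^t* *m Y ^t* = 1%:M by rewrite -adjmxM YX trmx1 map_mx1.
move: (gram_unit Gpos fB0); move EN : (B0 *m G *m B0 ^t* ) => N uN.
have -> : invmx (B *m G *m B ^t* ) = Y ^t* *m invmx N *m Y.
  have uB := gram_unit Gpos fB.
  apply: (can_inj (mulKmx uB)); rewrite mulmxV//.
  have -> : B *m G *m B ^t* = X *m N *m X ^t* by rewrite BX adjmxM -EN !mulmxA.
  by rewrite -!mulmxA (mulmxA (X ^t* )) XYs mul1mx (mulmxA N) mulmxV// mul1mx XY.
have -> : B *m A *m B ^t* = X *m (B0 *m A *m B0 ^t* ) *m X ^t*.
  by rewrite BX adjmxM !mulmxA.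
rewrite -!mulmxA (mulmxA (X ^t* )) XYs mul1mx [RHS]mxtrace_mulC.
by rewrite -!mulmxA YX mulmx1 !mulmxA.
Qed.

Lemma rel_mx_trace0 (G A : 'M[C]_n) m (E : 'M[C]_(m, n)) :
  \rank E = 0%N -> \tr (rel_mx G A E) = 0.
Proof.
by move=> E0; rewrite /mxtrace big1 //; case=> i lti; exfalso; rewrite E0 in lti.
Qed.

Lemma rel_mx_trace1 (G A : 'M[C]_n) m (E : 'M[C]_(m, n)) (u : 'rV[C]_n) :
  posdef G -> u != 0 -> (u :=: E)%MS ->
  \tr (rel_mx G A E) = (u *m A *m u ^t* ) 0 0 / (u *m G *m u ^t* ) 0 0.
Proof.
move=> Gpos u0 uE.
have fu : row_free u by rewrite /row_free rank_rV u0.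
rewrite (mxtrace_rel_mx A Gpos fu uE).
have [_ /(_ _ u0)/lt0r_neq0] := Gpos.
move: (gram_unit Gpos fu); move EN : (u *m G *m u ^t* ) => N uN N0.
rewrite {1}/mxtrace big_ord1 mxE big_ord1; congr (_ * _).
apply: (mulfI N0); rewrite divff//.
by have /matrixP/(_ 0 0) := mulmxV uN; rewrite !mxE big_ord1.
Qed.

(** In an orthogonal basis the Gram matrix of G is diagonal, so the trace is the
    sum of the two Rayleigh quotients. *)
Lemma rel_mx_trace2 (G A : 'M[C]_n) m (E : 'M[C]_(m, n)) (u v : 'rV[C]_n) :
  posdef G -> u != 0 -> v != 0 -> (u *m G *m v ^t* ) 0 0 = 0 ->
  (u <= E)%MS -> (v <= E)%MS -> \rank E = 2%N ->
  \tr (rel_mx G A E) = (u *m A *m u ^t* ) 0 0 / (u *m G *m u ^t* ) 0 0 +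
                       (v *m A *m v ^t* ) 0 0 / (v *m G *m v ^t* ) 0 0.
Proof.
move=> Gpos u0 v0 uv uE vE rE; have [/hermsymmxP GH Gp] := Gpos.
move: (lt0r_neq0 (Gp _ u0)) (lt0r_neq0 (Gp _ v0)).
move Enu : ((u *m G *m u ^t* ) 0 0) => nu.
move Env : ((v *m G *m v ^t* ) 0 0) => nv Nu Nv.
have s11 (M : 'M[C]_1) : M = (M 0 0)%:M by exact: mx11_scalar.
(* over 1 x 1 blocks orthogonality says that the Gram matrix is diagonal *)
have uv0 : u *m G *m v ^t* = 0 by rewrite [LHS]s11 uv raddf0.
have vu0 : v *m G *m u ^t* = 0.
  suff -> : v *m G *m u ^t* = (u *m G *m v ^t* ) ^t* by rewrite uv0 trmx0 map_mx0.
  by rewrite !adjmxM adjmxK -GH mulmxA.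
pose B := col_mx u v.
have NE : B *m G *m B ^t* = block_mx nu%:M 0 0 nv%:M.
  rewrite /B mul_col_mx tr_col_mx map_row_mx mul_col_row uv0 vu0.
  by rewrite [u *m G *m _]s11 [v *m G *m _]s11 Enu Env.
have fB : row_free B.
  rewrite -kermx_eq0; apply/negPn/negP => /rowV0Pn[x /sub_kermxP xB x0].
  have : x *m (B *m G *m B ^t* ) = 0 by rewrite !mulmxA xB !mul0mx.
  rewrite NE -[x]hsubmxK mul_row_block !mulmx0 addr0 add0r !mul_mx_scalar.
  move/eqP; rewrite row_mx_eq0 !scaler_eq0 (negPf Nu) (negPf Nv) /= => /andP[/eqP l0 /eqP r0].
  by move: x0; rewrite -[x]hsubmxK l0 r0 row_mx0 eqxx.
have BE : (B :=: E)%MS.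
  apply/eqmxP; rewrite -(geq_leqif (mxrank_leqif_eq _)).
    by rewrite (eqP fB) rE.
  by rewrite col_mx_sub uE vE.
rewrite (mxtrace_rel_mx A Gpos fB BE) NE.
have -> : invmx (block_mx nu%:M 0 0 nv%:M : 'M[C]_(1 + 1)) = block_mx nu^-1%:M 0 0 nv^-1%:M.
  have uN := gram_unit Gpos fB; rewrite NE in uN.
  apply: (can_inj (mulKmx uN)); rewrite mulmxV//.
  rewrite mulmx_block !mulmx0 !mul0mx !addr0 !add0r -!scalar_mxM.
  by rewrite (divff Nu) (divff Nv) -scalar_mx_block.
rewrite /B mul_col_mx tr_col_mx map_row_mx mul_col_row mulmx_block.
have tr11 (M : 'M[C]_1) k : \tr (M *m k%:M) = M 0 0 * k.
  by rewrite mul_mx_scalar mxtraceZ trace_mx11 mulrC.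
by rewrite mxtrace_block !mulmx0 addr0 add0r !tr11.
Qed.

End RelativeTrace.

(** * The Levi form as a real Hessian *)
Section LeviForm.
Context {R : realType} {n : nat}.
Local Notation C := R[i].
Local Notation V := (Cn R n).
Local Notation smooth := (@smooth_on R n setT).
Local Open Scope complex_scope.
Local Open Scope sesquilinear_scope.
Implicit Types (rho : V -> R) (z v : V) (L : 'rV[C]_n).

(** The real tangent vector 2 Re L in coordinates (x, y); [real_vecJ L] is its
    image by the complex structure. *)
Definition real_vec L : V := (map_mx (@complex.Re R) L, map_mx (@complex.Im R) L).
Definition real_vecJ L : V := (- map_mx (@complex.Im R) L, map_mx (@complex.Re R) L).

Lemma real_basis v : v = \sum_j (v.1 0 j *: ex j + v.2 0 j *: ey j).
Proof.
have -> : \sum_j (v.1 0 j *: @ex R n j + v.2 0 j *: ey j) =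
    (\sum_j v.1 0 j *: delta_mx 0 j, \sum_j v.2 0 j *: delta_mx 0 j).
  elim/big_ind3 : _ => // [a b c d e f -> -> //|j _].
  by rewrite [LHS]surjective_pairing; congr pair => /=; rewrite scaler0 ?addr0 ?add0r.
by case: v => a b /=; rewrite -!row_sum_delta.
Qed.

Lemma derive_sum_basis rho z v : smooth rho -> 'D_v rho z =
  \sum_j (v.1 0 j * 'D_(ex j) rho z + v.2 0 j * 'D_(ey j) rho z).
Proof.
move=> sr; have dr := smooth_differentiable z sr.
rewrite [in LHS](real_basis v) deriveE// linear_sum.
apply: eq_bigr => j _.
by rewrite linearD !scalar_linearZ -!deriveE.
Qed.

Lemma derive2_sum_basis rho z u v : smooth rho -> 'D_u ('D_v rho) z =
  \sum_k (v.1 0 k * 'D_u ('D_(ex k) rho) z + v.2 0 k * 'D_u ('D_(ey k) rho) z).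
Proof.
move=> sr.
transitivity ('D_u (\sum_(k < n) ((v.1 0 k \*: ('D_(ex k) rho : V -> R^o)) +
   (v.2 0 k \*: ('D_(ey k) rho : V -> R^o)))) z).
  congr (derive _ z u); apply/funext => x.
  by rewrite (derive_sum_basis _ _ sr) fct_sumE.
have dD w : derivable ('D_w rho) z u by apply/smooth_derivable/smooth_derive.
rewrite derive_sum; last first.
  by move=> k; apply: derivableD; apply: derivableZ; apply: dD.
apply: eq_bigr => k _.
have dZ c w : is_derive z u (c \*: ('D_w rho : V -> R^o)) (c * 'D_u ('D_w rho) z).
  by apply: is_deriveZ; apply: DeriveDef => //; apply: dD.
by have [] := is_deriveD (dZ (v.1 0 k) (ex k)) (dZ (v.2 0 k) (ey k)).
Qed.

Lemma ReM (x y : C) : complex.Re (x * y) =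
  complex.Re x * complex.Re y - complex.Im x * complex.Im y.
Proof. by case: x => a b; case: y. Qed.

Lemma ImM (x y : C) : complex.Im (x * y) =
  complex.Re x * complex.Im y + complex.Im x * complex.Re y.
Proof. by case: x => a b; case: y. Qed.

Lemma half_complex (a b : R) : (a +i* b) / 2%:R = (a / 2) +i* (b / 2).
Proof.
apply: (mulIf (_ : 2%:R != 0 :> C)); first by rewrite pnatr_eq0.
rewrite divfK ?pnatr_eq0//.
have -> : 2%:R = 2 +i* 0 :> C by apply/eqP; rewrite eq_complex /= addr0 !eqxx.
by apply/eqP; rewrite eq_complex /= !mulr0 subr0 add0r !divfK// !eqxx.
Qed.

Lemma cderive_real rho v z : cderive v (fun w => (rho w)%:C) z = ('D_v rho z)%:C.
Proof.
rewrite /cderive; congr (_ +i* _).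
by rewrite (_ : (fun w => complex.Im (rho w)%:C) = cst 0)// derive_cst.
Qed.

Lemma dz_real rho j z : dz j (fun w => (rho w)%:C) z =
  ('D_(ex j) rho z / 2) -i* ('D_(ey j) rho z / 2).
Proof.
rewrite /dz !cderive_real -(mulNr ('D_(ey j) rho z)) -half_complex.
congr (_ / _).
move: ('D_(ex j) rho z) ('D_(ey j) rho z) => p q.
by apply/eqP; rewrite eq_complex /=; apply/andP; split; apply/eqP; ring.
Qed.

Lemma dzbar_real rho j z : dzbar j (fun w => (rho w)%:C) z =
  ('D_(ex j) rho z / 2) +i* ('D_(ey j) rho z / 2).
Proof.
rewrite /dzbar !cderive_real -half_complex; congr (_ / _).
move: ('D_(ex j) rho z) ('D_(ey j) rho z) => p q.
by apply/eqP; rewrite eq_complex /=; apply/andP; split; apply/eqP; ring.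
Qed.

Lemma dz_algebra (p q r s : R) :
  ((p / 2 +i* (q / 2)) - 'i * (r / 2 +i* (s / 2))) / 2%:R =
  ((p + s) / 4) +i* ((q - r) / 4) :> C.
Proof.
have -> : (p / 2 +i* (q / 2)) - 'i * (r / 2 +i* (s / 2)) =
    ((p + s) / 2) +i* ((q - r) / 2) :> C.
  by apply/eqP; rewrite eq_complex /=; apply/andP; split; apply/eqP; ring.
rewrite half_complex; congr (_ +i* _); rewrite -mulrA; congr (_ * _).
all: by rewrite -invfM -natrM.
Qed.

Lemma levi_mxE rho z j k : smooth rho -> levi_mx rho z j k =
  (('D_(ex j) ('D_(ex k) rho) z + 'D_(ey j) ('D_(ey k) rho) z) / 4) +i*
  (('D_(ex j) ('D_(ey k) rho) z - 'D_(ey j) ('D_(ex k) rho) z) / 4).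
Proof.
move=> sr; rewrite mxE.
have -> : dzbar k (fun w => (rho w)%:C) =
    fun w => ('D_(ex k) rho w / 2) +i* ('D_(ey k) rho w / 2).
  by apply/funext => w; rewrite dzbar_real.
have half u v : 'D_u (fun w => 'D_v rho w / 2) z = 'D_u ('D_v rho) z / 2.
  have dD : derivable ('D_v rho) z u by apply/smooth_derivable/smooth_derive.
  by rewrite [RHS]mulrC -(deriveMr _ dD).
have hE u : cderive u (fun w => ('D_(ex k) rho w / 2) +i* ('D_(ey k) rho w / 2)) z =
    ('D_u ('D_(ex k) rho) z / 2) +i* ('D_u ('D_(ey k) rho) z / 2).
  by congr (_ +i* _); exact: half.
rewrite /dz (hE (ex j)) (hE (ey j)); exact: dz_algebra.
Qed.

(** The real bilinear form whose blocks, in the coordinates (x, y), are the four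
    matrices given. *)
Definition real_bilin (hxx hxy hyx hyy : 'I_n -> 'I_n -> R) (u v : V) : R :=
  \sum_k \sum_j (u.1 0 j * v.1 0 k * hxx j k + u.1 0 j * v.2 0 k * hxy j k +
                 (u.2 0 j * v.1 0 k * hyx j k + u.2 0 j * v.2 0 k * hyy j k)).

(** M is the (1,1)-part of the real form up to its antihermitian part, which
    contributes nothing to the real part of L M L^*.  Working with the real part
    avoids the symmetry of second derivatives. *)
Lemma hermitian_part_real_bilin hxx hxy hyx hyy (M : 'M[C]_n) L :
  (forall j k, M j k =
    ((hxx j k + hyy j k) / 4) +i* ((hxy j k - hyx j k) / 4)) ->
  complex.Re ((L *m M *m L ^t* ) 0 0) =
  (real_bilin hxx hxy hyx hyy (real_vec L) (real_vec L) +
   real_bilin hxx hxy hyx hyy (real_vecJ L) (real_vecJ L)) / 4.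
Proof.
move=> ME; rewrite mxE.
under eq_bigr do rewrite mxE mulr_suml.
rewrite (raddf_sum (@complex.Re R : Rcomplex R -> R)).
under eq_bigr do rewrite (raddf_sum (@complex.Re R : Rcomplex R -> R)).
rewrite /real_bilin -big_split mulr_suml /=; apply: eq_bigr => k _.
rewrite -big_split mulr_suml /=; apply: eq_bigr => j _.
rewrite ME !mxE; case: (L 0 j) => a b; case: (L 0 k) => c d.
rewrite !ReM !ImM /=; by field.
Qed.

Lemma hessian_real_bilin rho z u v : smooth rho -> 'D_u ('D_v rho) z =
  real_bilin (fun j k => 'D_(ex j) ('D_(ex k) rho) z)
        (fun j k => 'D_(ex j) ('D_(ey k) rho) z)
        (fun j k => 'D_(ey j) ('D_(ex k) rho) z)
        (fun j k => 'D_(ey j) ('D_(ey k) rho) z) u v.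
Proof.
move=> sr; apply: etrans (derive2_sum_basis z u v sr) _; apply: eq_bigr => k _.
have alg (a b x y : R) (f g f' g' : 'I_n -> R) :
    x = \sum_j (u.1 0 j * f j + u.2 0 j * g j) ->
    y = \sum_j (u.1 0 j * f' j + u.2 0 j * g' j) ->
    a * x + b * y = \sum_j (u.1 0 j * a * f j + u.1 0 j * b * f' j +
                            (u.2 0 j * a * g j + u.2 0 j * b * g' j)).
  move=> -> ->; rewrite !mulr_sumr -big_split; apply: eq_bigr => j _ /=; ring.
apply: alg; first exact: (derive_sum_basis z u (smooth_derive (ex k) sr)).
exact: (derive_sum_basis z u (smooth_derive (ey k) sr)).
Qed.

Lemma levi_formE rho z L : smooth rho ->
  complex.Re ((L *m levi_mx rho z *m L ^t* ) 0 0) =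
  ('D_(real_vec L) ('D_(real_vec L) rho) z +
   'D_(real_vecJ L) ('D_(real_vecJ L) rho) z) / 4.
Proof.
move=> sr; apply: etrans (hermitian_part_real_bilin L (fun j k => levi_mxE z j k sr)) _.
by congr ((_ + _) / 4); apply: esym; exact: hessian_real_bilin.
Qed.

Lemma mul_dz_col (X Y : 'I_n -> R) (c : 'cV[C]_n) L :
  (forall j, c j 0 = (X j / 2) -i* (Y j / 2)) ->
  (L *m c) 0 0 =
  ((\sum_j ((real_vec L).1 0 j * X j + (real_vec L).2 0 j * Y j)) / 2) -i*
  ((\sum_j ((real_vecJ L).1 0 j * X j + (real_vecJ L).2 0 j * Y j)) / 2).
Proof.
move=> cE; apply/eqP; rewrite eq_complex /= mxE.
rewrite (raddf_sum (@complex.Re R : Rcomplex R -> R)).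
rewrite (raddf_sum (@complex.Im R : Rcomplex R -> R)).
rewrite !mulr_suml -sumrN; apply/andP; split; apply/eqP; apply: eq_bigr => j _;
  rewrite ?mxE cE; case: (L 0 j) => a b; rewrite ?ReM ?ImM /=; ring.
Qed.

(** The complex number sum_j L_j d rho / d z_j is half of
    d rho (L) - i d rho (J L), both evaluated on real vectors. *)
Lemma T10P rho z L : smooth rho ->
  (L <= T10 rho z)%MS <-> 'D_(real_vec L) rho z = 0 /\ 'D_(real_vecJ L) rho z = 0.
Proof.
move=> sr.
have E : (L *m (\col_(j < n) dz j (fun w => (rho w)%:C) z)) 0 0 =
    ('D_(real_vec L) rho z / 2) -i* ('D_(real_vecJ L) rho z / 2).
  have dzE j : (\col_(j < n) dz j (fun w => (rho w)%:C) z) j 0 =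
      ('D_(ex j) rho z / 2) -i* ('D_(ey j) rho z / 2).
    by rewrite mxE; exact: dz_real.
  apply: etrans (mul_dz_col L dzE) _.
  by congr (_ / 2 -i* (_ / 2)); apply: esym; exact: derive_sum_basis.
have half0 (x y : R) : x / 2 -i* (y / 2) = 0 -> x = 0 /\ y = 0.
  move/eqP; rewrite eq_complex /= oppr_eq0 !mulf_eq0 invr_eq0 pnatr_eq0 !orbF.
  by case/andP => /eqP-> /eqP->.
split.
  by move=> /sub_kermxP/matrixP/(_ 0 0); rewrite E mxE => /half0.
move=> [h1 h2]; apply/sub_kermxP/matrixP => i j; rewrite !ord1 E h1 h2 !mxE mul0r.
by rewrite oppr0.
Qed.

End LeviForm.

(** * The model defining function *)
Section PointwiseDerivative.
Context {R : realType} {n : nat}.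
Local Notation V := (Cn R n).
Implicit Types (z v : V) (f g : V -> R).

(** [is_derive] without its class status: applying a rule of the calculus to a
    goal [has_deriv _ _ _ ?d] does not start an instance search. *)
Definition has_deriv f z v (d : R) : Prop := is_derive z v f d.

Lemma has_deriv_eq f z v d d' : has_deriv f z v d -> d = d' -> has_deriv f z v d'.
Proof. by move=> h <-. Qed.

Lemma has_derivD f g z v a b : has_deriv f z v a -> has_deriv g z v b ->
  has_deriv (fun w => f w + g w) z v (a + b).
Proof. exact: is_deriveD. Qed.

Lemma has_derivN f z v a : has_deriv f z v a ->
  has_deriv (fun w => - f w) z v (- a).
Proof. exact: is_deriveN. Qed.

Lemma has_derivM f g z v a b : has_deriv f z v a -> has_deriv g z v b ->
  has_deriv (fun w => f w * g w) z v (f z * b + g z * a).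
Proof. exact: is_deriveM. Qed.

Lemma has_derivX f k z v a : has_deriv f z v a ->
  has_deriv (fun w => f w ^+ k) z v (k%:R * f z ^+ k.-1 * a).
Proof. by move=> h; rewrite /has_deriv -exprfctE; exact: is_deriveX. Qed.

Lemma has_deriv_cst c z v : has_deriv (fun=> c) z v 0.
Proof. exact: is_derive_cst. Qed.

End PointwiseDerivative.

Ltac derive_poly :=
  repeat first
    [ exact: has_deriv_cst
    | exact: is_derive_re_coord
    | exact: is_derive_im_coord
    | apply: has_derivX
    | apply: has_derivN
    | apply: has_derivD
    | apply: has_derivM ].

Section Model.
Context {R : realType}.
Local Notation C := R[i].
Local Notation V := (Cn R 3).
Local Notation smooth := (@smooth_on R 3 setT).
Local Open Scope complex_scope.
Local Open Scope sesquilinear_scope.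
Implicit Types (z v u : V) (f g : V -> R).

Definition i1 : 'I_3 := @Ordinal 3 0 isT.
Definition i2 : 'I_3 := @Ordinal 3 1 isT.
Definition i3 : 'I_3 := @Ordinal 3 2 isT.

Lemma sum3 (M : zmodType) (F : 'I_3 -> M) : \sum_j F j = F i1 + F i2 + F i3.
Proof.
rewrite !big_ord_recl big_ord0 addr0 addrA.
by congr (F _ + F _ + F _); apply: val_inj.
Qed.

Lemma ord3_ind (P : 'I_3 -> Prop) : P i1 -> P i2 -> P i3 -> forall j, P j.
Proof.
move=> p1 p2 p3 [[|[|[|j]]] lj] //.
- by rewrite (_ : Ordinal lj = i1)//; apply: val_inj.
- by rewrite (_ : Ordinal lj = i2)//; apply: val_inj.
- by rewrite (_ : Ordinal lj = i3)//; apply: val_inj.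
Qed.

Definition x1 z := re_coord i1 z.
Definition y1 z := im_coord i1 z.
Definition x2 z := re_coord i2 z.
Definition y2 z := im_coord i2 z.
Definition x3 z := re_coord i3 z.
Definition y3 z := im_coord i3 z.
Definition sqn1 z := x1 z ^+ 2 + y1 z ^+ 2.
Definition sqn2 z := x2 z ^+ 2 + y2 z ^+ 2.

Definition base_fun z :=
  2 * x2 z ^+ 3 - 3 * x2 z * (sqn1 z * (sqn1 z + y2 z ^+ 2)) + sqn2 z ^+ 2 +
  (sqn1 z + sqn2 z) ^+ 3.

Definition rho0 z := x3 z ^+ 2 + (y3 z - 1) ^+ 2 - 1 + base_fun z.

(** Partial derivatives of [base_fun], seen as a function of a = |z1|^2, x = Re z2
    and y = Im z2. *)
Definition Fa z := - 6 * x2 z * sqn1 z - 3 * x2 z * y2 z ^+ 2 + 3 * (sqn1 z + sqn2 z) ^+ 2.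
Definition Fx z := 6 * x2 z ^+ 2 - 3 * (sqn1 z * (sqn1 z + y2 z ^+ 2)) + 4 * sqn2 z * x2 z +
  6 * x2 z * (sqn1 z + sqn2 z) ^+ 2.
Definition Fy z := - 6 * x2 z * sqn1 z * y2 z + 4 * sqn2 z * y2 z +
  6 * y2 z * (sqn1 z + sqn2 z) ^+ 2.
Definition Faa z := - 6 * x2 z + 6 * (sqn1 z + sqn2 z).
Definition Fax z := - 6 * sqn1 z - 3 * y2 z ^+ 2 + 12 * x2 z * (sqn1 z + sqn2 z).
Definition Fay z := - 6 * x2 z * y2 z + 12 * y2 z * (sqn1 z + sqn2 z).
Definition Fxx z := 12 * x2 z + 4 * sqn2 z + 8 * x2 z ^+ 2 + 6 * (sqn1 z + sqn2 z) ^+ 2 +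
  24 * x2 z ^+ 2 * (sqn1 z + sqn2 z).
Definition Fxy z := - 6 * sqn1 z * y2 z + 8 * x2 z * y2 z +
  24 * x2 z * y2 z * (sqn1 z + sqn2 z).
Definition Fyy z := - 6 * x2 z * sqn1 z + 4 * sqn2 z + 8 * y2 z ^+ 2 +
  6 * (sqn1 z + sqn2 z) ^+ 2 + 24 * y2 z ^+ 2 * (sqn1 z + sqn2 z).

Definition drho0 v z :=
  2 * (x1 z * x1 v + y1 z * y1 v) * Fa z + x2 v * Fx z + y2 v * Fy z +
  2 * x3 z * x3 v + 2 * (y3 z - 1) * y3 v.

Definition ddrho0 v z :=
  2 * (x1 v ^+ 2 + y1 v ^+ 2) * Fa z +
  4 * (x1 z * x1 v + y1 z * y1 v) ^+ 2 * Faa z +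
  4 * (x1 z * x1 v + y1 z * y1 v) * (Fax z * x2 v + Fay z * y2 v) +
  Fxx z * x2 v ^+ 2 + 2 * Fxy z * x2 v * y2 v + Fyy z * y2 v ^+ 2 +
  2 * x3 v ^+ 2 + 2 * y3 v ^+ 2.

Ltac unfold_model := rewrite /rho0 /base_fun /drho0 /ddrho0 /Fa /Fx /Fy /Faa /Fax /Fay
  /Fxx /Fxy /Fyy /sqn1 /sqn2 /x1 /y1 /x2 /y2 /x3 /y3.

Lemma derive_rho0 z v : 'D_v rho0 z = drho0 v z.
Proof.
suff : has_deriv rho0 z v (drho0 v z) by case.
rewrite /rho0 /base_fun /sqn1 /sqn2 /x1 /y1 /x2 /y2 /x3 /y3.
apply: has_deriv_eq; first by derive_poly.
unfold_model => /=; ring.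
Qed.

Lemma derive2_rho0 z v : 'D_v ('D_v rho0) z = ddrho0 v z.
Proof.
have -> : 'D_v rho0 = drho0 v by apply/funext => w; exact: derive_rho0.
suff : has_deriv (drho0 v) z v (ddrho0 v z) by case.
rewrite /drho0 /Fa /Fx /Fy /sqn1 /sqn2 /x1 /y1 /x2 /y2 /x3 /y3.
apply: has_deriv_eq; first by derive_poly.
unfold_model => /=; ring.
Qed.

End Model.

Section ModelEstimates.
Context {R : realType}.
Local Notation C := R[i].
Local Notation V := (Cn R 3).
Local Notation smooth := (@smooth_on R 3 setT).
Local Open Scope complex_scope.
Local Open Scope sesquilinear_scope.
Implicit Types (z v u : V) (L : 'rV[C]_3).

Definition row3 {T : nmodType} (a b c : T) : 'rV[T]_3 := \row_j [:: a; b; c]`_j.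

(** [H11] and [H22] are the diagonal coefficients F_{1 1bar} and F_{2 2bar} of the
    complex Hessian of F; [cross] below is the real part of twice the
    off-diagonal term, and [leviQ] the full Levi form of [rho0]. *)
Definition H11 z : R := Fa z + sqn1 z * Faa z.
Definition H22 z : R := (Fxx z + Fyy z) / 4.
Definition psi z : R := 4 * sqn1 z + y2 z ^+ 2 + sqn2 z ^+ 2.

Definition nsq (c : C) : R := complex.Re c ^+ 2 + complex.Im c ^+ 2.

Definition cross z (c d : C) : R :=
  let A := complex.Re c * complex.Re d + complex.Im c * complex.Im d in
  let B := complex.Im c * complex.Re d - complex.Re c * complex.Im d in
  Fax z * (x1 z * A + y1 z * B) - Fay z * (x1 z * B - y1 z * A).

Definition leviQ z L : R :=
  H11 z * nsq (L 0 i1) + H22 z * nsq (L 0 i2) + nsq (L 0 i3) + cross z (L 0 i1) (L 0 i2).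

Lemma smooth_rho0 : smooth (@rho0 R).
Proof.
rewrite /rho0 /base_fun /sqn1 /sqn2 /x1 /y1 /x2 /y2 /x3 /y3.
smooth_poly.
Qed.

Lemma leviQE z L :
  (ddrho0 (real_vec L) z + ddrho0 (real_vecJ L) z) / 4 = leviQ z L.
Proof.
rewrite /leviQ /cross /nsq /ddrho0 /H11 /H22.
rewrite /(x1 (real_vec _)) /(y1 (real_vec _)) /(x2 (real_vec _)) /(y2 (real_vec _)).
rewrite /(x3 (real_vec _)) /(y3 (real_vec _)).
rewrite /(x1 (real_vecJ _)) /(y1 (real_vecJ _)) /(x2 (real_vecJ _)) /(y2 (real_vecJ _)).
rewrite /(x3 (real_vecJ _)) /(y3 (real_vecJ _)).
rewrite /re_coord /im_coord !mxE /=.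
case: (L 0 i1) => a b; case: (L 0 i2) => c d; case: (L 0 i3) => e f /=.
rewrite /sqn1; by field.
Qed.

Lemma levi_rho0 z L :
  complex.Re ((L *m levi_mx (@rho0 R) z *m L ^t* ) 0 0) = leviQ z L.
Proof.
apply: etrans (levi_formE z L smooth_rho0) _; rewrite -leviQE.
by congr ((_ + _) / 4); exact: derive2_rho0.
Qed.

Lemma H11E z : H11 z = - 12 * x2 z * sqn1 z - 3 * x2 z * y2 z ^+ 2 +
  3 * (sqn1 z + sqn2 z) * (3 * sqn1 z + sqn2 z).
Proof. by rewrite /H11 /Fa /Faa; ring. Qed.

Lemma H22E z : H22 z = 3 * x2 z - 3 / 2 * (x2 z * sqn1 z) + 4 * sqn2 z +
  3 * (sqn1 z + sqn2 z) * (sqn1 z + 3 * sqn2 z).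
Proof. by rewrite /H22 /Fxx /Fyy /sqn2; field. Qed.

Lemma sqn1_ge0 z : 0 <= sqn1 z.
Proof. by rewrite addr_ge0 ?sqr_ge0. Qed.

Lemma sqn2_ge0 z : 0 <= sqn2 z.
Proof. by rewrite addr_ge0 ?sqr_ge0. Qed.

Lemma sqn2_ge z : x2 z ^+ 2 <= sqn2 z /\ y2 z ^+ 2 <= sqn2 z.
Proof. by rewrite /sqn2; split; rewrite ?lerDl ?lerDr sqr_ge0. Qed.

Lemma psi_ge0 z : 0 <= psi z.
Proof.
have a0 := sqn1_ge0 z.
by rewrite /psi addr_ge0 ?sqr_ge0// addr_ge0 ?sqr_ge0// mulr_ge0.
Qed.

(** The cubic parts of H11 and of psi H22 cancel.  What is left is split into
    four nonnegative pieces: 9 a^2 + 12 ab, 3 b (4a + y^2), 3 b^2 (1 + x + b) and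
    a multiple of psi; the last two use b >= x^2. *)
Lemma weighted_levi_ge0 z : 0 <= H11 z + psi z * H22 z.
Proof.
rewrite H11E H22E /psi.
have a0 := sqn1_ge0 z; have b0 := sqn2_ge0 z; have [xb yb] := sqn2_ge z.
have y0 : 0 <= y2 z ^+ 2 by exact: sqr_ge0.
move: (sqn1 z) (sqn2 z) (x2 z) (y2 z ^+ 2) a0 b0 xb y0 => a b x y a0 b0 xb y0.
have p0 : 0 <= 4 * a + y + b ^+ 2 by rewrite !addr_ge0 ?mulr_ge0 ?sqr_ge0.
have e1 : 0 <= b - 3 / 2 * (x * a) + 3 * a ^+ 2.
  by have := sqr_ge0 (x - 3 / 4 * a); have := sqr_ge0 a; nra.
have e2 : 0 <= (4 * a + y + b ^+ 2) *
    (b - 3 / 2 * (x * a) + 3 * a ^+ 2 + 3 * (4 * (a * b) + 3 * b ^+ 2)).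
  rewrite mulr_ge0// addr_ge0//; rewrite mulr_ge0//.
  by rewrite addr_ge0 ?mulr_ge0 ?sqr_ge0.
have e3 : 0 <= 3 * b * (4 * a + y).
  by rewrite !mulr_ge0// addr_ge0// mulr_ge0.
have e4 : 0 <= 3 * b ^+ 2 * (1 + x + b).
  rewrite mulr_ge0// ?mulr_ge0 ?sqr_ge0//.
  by have := sqr_ge0 (x + 1 / 2); nra.
have e5 : 0 <= 9 * a ^+ 2 + 12 * (a * b).
  by rewrite addr_ge0 ?mulr_ge0 ?sqr_ge0.
have -> : - 12 * x * a - 3 * x * y + 3 * (a + b) * (3 * a + b) +
    (4 * a + y + b ^+ 2) *
      (3 * x - 3 / 2 * (x * a) + 4 * b + 3 * (a + b) * (a + 3 * b)) =
  (4 * a + y + b ^+ 2) *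
    (b - 3 / 2 * (x * a) + 3 * a ^+ 2 + 3 * (4 * (a * b) + 3 * b ^+ 2)) +
  3 * b * (4 * a + y) + 3 * b ^+ 2 * (1 + x + b) + (9 * a ^+ 2 + 12 * (a * b)).
  by field.
exact: addr_ge0 (addr_ge0 (addr_ge0 e2 e3) e4) e5.
Qed.

(** With z1 of weight 1 and z2 of weight 2, F is a sum of terms of weights 6, 8,
    10 and 12; this is the part of weight 8.  The last two are visibly
    nonnegative, which makes F monotone along the dilations once weight 6 is
    divided out. *)
Lemma weight8_ge0 z :
  0 <= sqn2 z ^+ 2 - 3 * x2 z * y2 z ^+ 2 * sqn1 z + 3 * sqn1 z ^+ 2 * sqn2 z.
Proof.
have a0 := sqn1_ge0 z; have b0 := sqn2_ge0 z; have [xb yb] := sqn2_ge z.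
have y0 : 0 <= y2 z ^+ 2 by exact: sqr_ge0.
move: (sqn1 z) (sqn2 z) (x2 z) (y2 z ^+ 2) a0 b0 xb yb y0 => a b x y a0 b0 xb yb y0.
have e1 : 0 <= (b - y) * (b + 3 * a ^+ 2).
  by rewrite mulr_ge0 ?subr_ge0// addr_ge0// mulr_ge0 ?sqr_ge0.
have e2 : 0 <= y * (b - 3 * (x * a) + 3 * a ^+ 2).
  rewrite mulr_ge0//.
  by have := sqr_ge0 (x - 3 / 2 * a); have := sqr_ge0 a; nra.
have -> : b ^+ 2 - 3 * x * y * a + 3 * a ^+ 2 * b =
    (b - y) * (b + 3 * a ^+ 2) + y * (b - 3 * (x * a) + 3 * a ^+ 2) by ring.
exact: addr_ge0.
Qed.

(** Generator of the weighted dilations with centre (0, 0, i): by Euler's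
    identity it is transverse to the zero set of [rho0]. *)
Definition euler_vec z : V :=
  (row3 (x1 z) (2 * x2 z) (3 * x3 z), row3 (y1 z) (2 * y2 z) (3 * (y3 z - 1))).

Lemma drho0_euler z : rho0 z = 0 -> 6 <= drho0 (euler_vec z) z.
Proof.
move=> r0.
have -> : drho0 (euler_vec z) z =
    6 + 6 * rho0 z +
    2 * (sqn2 z ^+ 2 - 3 * x2 z * y2 z ^+ 2 * sqn1 z + 3 * sqn1 z ^+ 2 * sqn2 z) +
    12 * (sqn1 z * sqn2 z ^+ 2) + 6 * sqn2 z ^+ 3.
  rewrite /drho0 /(x1 (euler_vec _)) /(y1 (euler_vec _)) /(x2 (euler_vec _))
    /(y2 (euler_vec _)) /(x3 (euler_vec _)) /(y3 (euler_vec _)).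
  rewrite /re_coord /im_coord /euler_vec /row3 !mxE /=.
  rewrite /rho0 /base_fun /Fa /Fx /Fy /sqn1 /sqn2; ring.
have k1 := weight8_ge0 z.
have k2 : 0 <= sqn1 z * sqn2 z ^+ 2 by rewrite mulr_ge0 ?sqr_ge0 ?sqn1_ge0.
have k3 : 0 <= sqn2 z ^+ 3 by rewrite exprn_ge0 ?sqn2_ge0.
by rewrite r0; lra.
Qed.

(** The quintic term of F is absorbed by 3/8 of the sextic one, up to lower order,
    thanks to 3 x <= 6 + 3 x^2 / 8, that is (x - 4)^2 >= 0. *)
Lemma rho0_bound z : rho0 z < 0 ->
  sqn1 z + sqn2 z < 16 /\ x3 z ^+ 2 + (y3 z - 1) ^+ 2 < 2000.
Proof.
rewrite /rho0 /base_fun.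
have a0 := sqn1_ge0 z; have b0 := sqn2_ge0 z; have [xb yb] := sqn2_ge z.
have y0 : 0 <= y2 z ^+ 2 by exact: sqr_ge0.
have w0 : 0 <= x3 z ^+ 2 + (y3 z - 1) ^+ 2 by rewrite addr_ge0 ?sqr_ge0.
move: (sqn1 z) (sqn2 z) (x2 z) (y2 z ^+ 2) (x3 z ^+ 2 + (y3 z - 1) ^+ 2)
  a0 b0 xb yb y0 w0 => a b x y w a0 b0 xb yb y0 w0 r0.
pose s := a + b.
have s0 : 0 <= s by rewrite addr_ge0.
have bs : b <= s by rewrite lerDr.
have x2s : x ^+ 2 <= s by exact: le_trans bs.
have as2 : a * (a + y) <= s ^+ 2.
  rewrite expr2 ler_pM// ?addr_ge0// ?lerDl// lerD2l//.
have e1 : - (2 * x ^+ 3) <= s + s ^+ 2.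
  have : 0 <= x ^+ 2 * (x + 1) ^+ 2 by rewrite mulr_ge0 ?sqr_ge0.
  have : x ^+ 2 * x ^+ 2 <= s * s by rewrite ler_pM ?sqr_ge0.
  by nra.
have e2 : 3 * x * (a * (a + y)) <= (6 + 3 / 8 * s) * s ^+ 2.
  have k1 : 3 * x <= 6 + 3 / 8 * s by have := sqr_ge0 (x - 4); nra.
  have k2 : 0 <= 6 + 3 / 8 * s by rewrite addr_ge0// mulr_ge0.
  have k3 : 0 <= a * (a + y) by rewrite mulr_ge0// addr_ge0.
  by apply: le_trans (ler_wpM2r k3 k1) _; exact: ler_wpM2l.
have e3 : 0 <= b ^+ 2 by exact: sqr_ge0.
have F1 : 5 / 8 * s ^+ 3 - 7 * s ^+ 2 - s <=
    2 * x ^+ 3 - 3 * x * (a * (a + y)) + b ^+ 2 + s ^+ 3.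
  have -> : 5 / 8 * s ^+ 3 - 7 * s ^+ 2 - s =
    - (s + s ^+ 2) - ((6 + 3 / 8 * s) * s ^+ 2) + s ^+ 3 by field.
  lra.
have lt16 : s < 16.
  rewrite ltNge; apply/negP => s16.
  have k1 : 0 <= s ^+ 2 * (s - 16) by rewrite mulr_ge0 ?sqr_ge0 ?subr_ge0.
  have k2 : 0 <= s * (s - 16) by rewrite mulr_ge0 ?subr_ge0.
  have : 5 / 8 * s ^+ 3 - 7 * s ^+ 2 - s = 5 / 8 * (s ^+ 2 * (s - 16)) +
    3 * (s * (s - 16)) + 47 * s by field.
  rewrite -/s in r0; lra.
split => //.
have k1 : 0 <= s ^+ 3 by rewrite exprn_ge0.
have k2 : 0 <= s * (16 - s) by rewrite mulr_ge0 ?subr_ge0// ltW.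
have k3 : s ^+ 2 = 16 * s - s * (16 - s) by ring.
rewrite -/s in r0; lra.
Qed.

End ModelEstimates.

(** * The domain *)
Section ModelDomain.
Context {R : realType}.
Local Notation V := (Cn R 3).
Implicit Types (z v : V).

Definition Omega0 : set V := [set z | rho0 z < 0].

Lemma boundary_Omega0 z : boundary Omega0 z <-> rho0 z = 0.
Proof.
split=> [|r0]; first exact: boundary_eq0 smooth_rho0 erefl.
apply: (@eq0_boundary _ _ _ rho0 z (euler_vec z) smooth_rho0) => //.
by rewrite derive_rho0 gt_eqF// (lt_le_trans _ (drho0_euler r0)).
Qed.

Lemma defining_rho0 : defining_function Omega0 rho0.
Proof.
split=> [|//|z /boundary_Omega0 r0]; first exact: smooth_rho0.
exists (euler_vec z); rewrite -deriveE; last exact: smooth_differentiable smooth_rho0.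
by rewrite derive_rho0 gt_eqF// (lt_le_trans _ (drho0_euler r0)).
Qed.

Lemma rho00 : rho0 (0 : V) = 0.
Proof.
rewrite /rho0 /base_fun /sqn1 /sqn2 /x1 /y1 /x2 /y2 /x3 /y3 /re_coord /im_coord.
by rewrite !mxE; ring.
Qed.

Lemma bounded_Omega0 : bounded_set Omega0.
Proof.
suff bnd z j : Omega0 z -> `|z.1 0 j| <= 100 /\ `|z.2 0 j| <= 100.
  exists 100; split=> // M M100 z /bnd Oz; apply: le_trans (ltW M100).
  have bnd_row (u : 'rV[R]_3) : (forall j, `|u 0 j| <= 100) -> `|u| <= 100.
    move=> uj; rewrite (_ : `|u| = mx_norm u)// mx_normrE.
    by apply/bigmax_leP; split=> // -[i k] _ /=; rewrite ord1.
  by rewrite prod_normE ge_max; apply/andP; split; apply: bnd_row => j;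
    have [] := Oz j.
move=> /rho0_bound[]; rewrite /sqn1 /sqn2.
have sq (t : R) : t ^+ 2 <= 100 ^+ 2 -> `|t| <= 100.
  by move=> h; rewrite -(ler_pXn2r (ltn0Sn 1)) ?nnegrE// real_normK ?num_real.
have q1 := sqr_ge0 (x1 z); have q2 := sqr_ge0 (x2 z); have q3 := sqr_ge0 (x3 z).
have p1 := sqr_ge0 (y1 z); have p2 := sqr_ge0 (y2 z); have p3 := sqr_ge0 (y3 z - 1).
move=> h1 h2.
have hy3 : y3 z ^+ 2 <= 100 ^+ 2.
  have := sqr_ge0 (y3 z - 2); rewrite !expr2 in h1 h2 q1 q2 q3 p1 p2 p3 *; lra.
rewrite !expr2 in sq h1 h2 hy3 q1 q2 q3 p1 p2 p3.
by move: j; apply: ord3_ind; split; apply: sq;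
  [change (x1 z * x1 z <= 100 * 100) | change (y1 z * y1 z <= 100 * 100)
  |change (x2 z * x2 z <= 100 * 100) | change (y2 z * y2 z <= 100 * 100)
  |change (x3 z * x3 z <= 100 * 100) | change (y3 z * y3 z <= 100 * 100)]; lra.
Qed.

Definition dilate z (t : R) : V :=
  (0, row3 0 0 1) + (t *: (row3 (x1 z) 0 0, row3 (y1 z) 0 0) +
   (t ^+ 2 *: (row3 0 (x2 z) 0, row3 0 (y2 z) 0) +
    t ^+ 3 *: (row3 0 0 (x3 z), row3 0 0 (y3 z - 1)))).

Lemma continuous_dilate z : continuous (dilate z).
Proof.
move=> t; apply: cvgD; first exact: cvg_cst.
by apply: cvgD; [|apply: cvgD]; apply: cvgZr_tmp; [exact: cvg_id|exact: exprn_continuous..].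
Qed.

(** rho0 + 1 is a sum of terms of weights at least 6 whose parts of weight above
    6 are nonnegative, so a dilation by t multiplies it by at most t^6. *)
Lemma dilate_Omega0 z t : 0 <= t <= 1 -> Omega0 z -> Omega0 (dilate z t).
Proof.
move=> /andP[t0 t1]; rewrite /Omega0 /= => rz.
have xd : [/\ x1 (dilate z t) = t * x1 z, y1 (dilate z t) = t * y1 z,
   x2 (dilate z t) = t ^+ 2 * x2 z, y2 (dilate z t) = t ^+ 2 * y2 z &
   x3 (dilate z t) = t ^+ 3 * x3 z /\ y3 (dilate z t) = 1 + t ^+ 3 * (y3 z - 1)].
  by rewrite /dilate /row3; split; [..|split];
   rewrite /x1 /y1 /x2 /y2 /x3 /y3 /re_coord /im_coord !mxE /=; ring.
case: xd => ex1 ey1 ex2 ey2 [ex3 ey3].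
have t6 k : t ^+ k * t ^+ 6 <= t ^+ 6 by rewrite ler_piMl ?exprn_ge0// exprn_ile1.
have := weight8_ge0 z; set G := (X in 0 <= X) => G0.
have k1 : 0 <= sqn1 z * sqn2 z ^+ 2 by rewrite mulr_ge0 ?sqr_ge0 ?sqn1_ge0.
have k2 : 0 <= sqn2 z ^+ 3 by rewrite exprn_ge0 ?sqn2_ge0.
(* the parts of weights 8, 10 and 12 are scaled by t^8, t^10 and t^12 *)
have E : rho0 (dilate z t) + 1 = t ^+ 6 * (rho0 z + 1) -
   ((t ^+ 6 - t ^+ 2 * t ^+ 6) * G +
    3 * (t ^+ 6 - t ^+ 4 * t ^+ 6) * (sqn1 z * sqn2 z ^+ 2) +
    (t ^+ 6 - t ^+ 6 * t ^+ 6) * sqn2 z ^+ 3).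
  rewrite /G /rho0 /base_fun /sqn1 /sqn2 ex1 ey1 ex2 ey2 ex3 ey3; ring.
have e1 : rho0 (dilate z t) + 1 <= t ^+ 6 * (rho0 z + 1).
  rewrite E lerBlDr lerDl; apply: addr_ge0; first apply: addr_ge0.
  - by rewrite mulr_ge0// subr_ge0.
  - by rewrite mulr_ge0// mulr_ge0// subr_ge0.
  - by rewrite mulr_ge0// subr_ge0.
suff : t ^+ 6 * (rho0 z + 1) < 1 by lra.
have [neg|pos] := leP (rho0 z + 1) 0.
  by apply: le_lt_trans ltr01; rewrite mulr_ge0_le0// exprn_ge0.
apply: le_lt_trans (_ : rho0 z + 1 < 1); last lra.
by rewrite ler_piMl ?(ltW pos)// exprn_ile1.
Qed.

Lemma dilate0 z : dilate z 0 = (0, row3 0 0 1).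
Proof. by rewrite /dilate !expr0n !scale0r !addr0. Qed.

Lemma dilate1 z : dilate z 1 = z.
Proof.
rewrite /dilate !expr1n !scale1r /row3 [RHS]surjective_pairing /=.
congr pair; apply/rowP; apply: ord3_ind;
  rewrite !mxE /= /x1 /y1 /x2 /y2 /x3 /y3 /re_coord /im_coord; ring.
Qed.

Lemma connected_Omega0 : connected Omega0.
Proof.
have -> : Omega0 = \bigcup_(z in Omega0) (dilate z @` `[(0 : R), 1]%classic).
  apply/seteqP; split=> [z Oz|w [z Oz [t /=]]].
    by exists z => //; exists 1; rewrite ?dilate1//= in_itv /= ler01 lexx.
  by rewrite in_itv /= => /(dilate_Omega0)/(_ Oz) + <-.
apply: bigcup_connected => [|z _].
  exists (0, row3 0 0 1) => z _; exists 0; last exact: dilate0.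
  by rewrite /= in_itv /= ler01 lexx.
apply: connected_continuous_connected; first exact: segment_connected.
by apply: continuous_subspaceT; exact: continuous_dilate.
Qed.

Lemma center_Omega0 : Omega0 (0, row3 0 0 1).
Proof.
rewrite /Omega0 /= /rho0 /base_fun /sqn1 /sqn2 /x1 /y1 /x2 /y2 /x3 /y3.
rewrite /re_coord /im_coord /row3 !mxE /=.
have -> : (0 : R) ^+ 2 + (1 - 1) ^+ 2 - 1 +
  (2 * 0 ^+ 3 - 3 * 0 * ((0 ^+ 2 + 0 ^+ 2) * (0 ^+ 2 + 0 ^+ 2 + 0 ^+ 2)) +
  (0 ^+ 2 + 0 ^+ 2) ^+ 2 + (0 ^+ 2 + 0 ^+ 2 + (0 ^+ 2 + 0 ^+ 2)) ^+ 3) = -1 by ring.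
by rewrite oppr_lt0.
Qed.

Lemma smooth_bounded_domain_Omega0 : smooth_bounded_domain Omega0.
Proof.
split; [exact: defining_function_open defining_rho0|exact: connected_Omega0| |
  exact: bounded_Omega0|].
- by exists (0, row3 0 0 1); exact: center_Omega0.
- by exists rho0; exact: defining_rho0.
Qed.

End ModelDomain.

(** * Invariance of the Levi form *)
Section ChangeDefiningFunction.
Context {R : realType} {n : nat}.
Local Notation C := R[i].
Local Notation V := (Cn R n).
Local Open Scope complex_scope.
Local Open Scope sesquilinear_scope.
Implicit Types (L : 'rV[C]_n) (z : V).

Lemma real_vecK (v : V) : real_vec (\row_j (v.1 0 j +i* v.2 0 j)) = v.
Proof.
by rewrite [RHS]surjective_pairing; congr pair; apply/rowP => j; rewrite !mxE.
Qed.

Lemma rank_T10 (Omega : set V) rho z : defining_function Omega rho ->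
  boundary Omega z -> \rank (T10 rho z) = n.-1.
Proof.
move=> [sr _ reg] /reg[v]; rewrite -deriveE; last exact: smooth_differentiable.
move=> dv; rewrite mxrank_ker -subn1; congr (_ - _)%N.
apply/eqP; rewrite eqn_leq rank_leq_col lt0n mxrank_eq0.
apply: contra_neq dv => c0.
have LT : (\row_j (v.1 0 j +i* v.2 0 j) <= T10 rho z)%MS.
  by rewrite /T10 c0; apply/sub_kermxP; rewrite mulmx0.
have [+ _] := (T10P z _ sr).1 LT.
by rewrite real_vecK; apply.
Qed.

Lemma levi_proportional (Omega : set V) rho0 rho z :
  defining_function Omega rho0 -> defining_function Omega rho ->
  boundary Omega z ->
  exists2 h, 0 < h &
    (forall L, (L <= T10 rho z)%MS = (L <= T10 rho0 z)%MS) /\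
    forall L, (L <= T10 rho0 z)%MS ->
      complex.Re ((L *m levi_mx rho z *m L ^t* ) 0 0) =
      h * complex.Re ((L *m levi_mx rho0 z *m L ^t* ) 0 0).
Proof.
move=> D0 D1 bz; have [h h0 [h1 h2]] := defining_functions_proportional D0 D1 bz.
have [s0 _ _] := D0; have [s1 _ _] := D1.
exists h; first exact: h0.
split=> L.
  have eq0 a b : a = h * b -> a = 0 <-> b = 0.
    move=> ->; split=> [/eqP|->]; last by rewrite mulr0.
    by rewrite mulf_eq0 (gt_eqF h0) => /eqP.
  have eq0L v := eq0 _ _ (h1 v).
  apply/idP/idP.
    move=> /(T10P z L s1)[e1 e2]; apply: (T10P z L s0).2.
    by split; [exact: (eq0L _).1 e1|exact: (eq0L _).1 e2].
  move=> /(T10P z L s0)[e1 e2]; apply: (T10P z L s1).2.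
  by split; [exact: (eq0L _).2 e1|exact: (eq0L _).2 e2].
move=> /(T10P z L s0)[e1 e2].
have alg (a b c d x y : R) : x = (a + b) / 4 -> y = (c + d) / 4 ->
    a = h * c -> b = h * d -> x = h * y.
  by move=> -> -> -> ->; rewrite -mulrDr mulrA.
exact: alg (levi_formE z L s1) (levi_formE z L s0) (h2 _ e1) (h2 _ e2).
Qed.

(** An hermitian matrix P with image E and equal to the identity on E determines
    the Gram projector: if P = X B then X B B^* = (B P)^* = B^*. *)
Lemma orthogonal_projector m (E : 'M[C]_(m, n)) (P : 'M[C]_n) :
  let B := row_base E in
  P ^t* = P -> (P <= E)%MS -> B *m P = B ->
  B ^t* *m invmx (B *m B ^t* ) *m B = P.
Proof.
move=> B Ph PE BP.
have euclid : posdef (1%:M : 'M[C]_n).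
  split; first by apply/hermsymmxP; rewrite trmx1 map_mx1.
  move=> L L0; rewrite mulmx1 -dotmxE; exact: dotmx_is_dotmx.
have := gram_unit euclid (row_base_free E); rewrite mulmx1 -/B => uN.
have /submxP[X PX] : (P <= B)%MS by rewrite eq_row_base.
have BE : B ^t* = X *m (B *m B ^t* ).
  by rewrite mulmxA -PX -{1}BP adjmxM Ph.
by rewrite {1}BE (mulmxK uN) -PX.
Qed.

Lemma pairingE (eta Ups : 'M[C]_n) : pairing eta Ups = \tr (Ups *m eta).
Proof.
rewrite /pairing exchange_big /mxtrace; apply: eq_bigr => k _.
by rewrite mxE; apply: eq_bigr => j _.
Qed.

Lemma cauchy_schwarz_mx (L : 'rV[C]_n) (t : 'cV[C]_n) :
  ((L *m t) ^t* *m (L *m t)) 0 0 <= (L *m L ^t* ) 0 0 * (t ^t* *m t) 0 0.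
Proof.
have : `|dotmx L (t ^t* )| ^+ 2 <= dotmx L L * dotmx (t ^t* ) (t ^t* ).
  by have [] := CauchySchwarz (@dotmx C n) L (t ^t* ).
rewrite !dotmxE adjmxK normCK mulrC.
suff -> : ((L *m t) ^t* *m (L *m t)) 0 0 = ((L *m t) 0 0)^* * (L *m t) 0 0 by [].
by rewrite [LHS]mxE big_ord1 [X in X * _]mxE [X in X^* * _]mxE.
Qed.

End ChangeDefiningFunction.

(** * Complex-valued functions *)

(** A property of real functions which is stable under sums and products, such
    as smoothness or differentiability at a point, extends to complex functions
    by asking it of the real and imaginary parts. *)
Section Complexwise.
Context {R : realType} {n : nat}.
Local Notation C := R[i].
Local Notation V := (Cn R n).
Local Open Scope complex_scope.
Context (P : (V -> R) -> Prop).

Definition complexwise (f : V -> C) : Prop :=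
  P (fun z => complex.Re (f z)) /\ P (fun z => complex.Im (f z)).

Context (Pcst : forall c, P (fun=> c)).
Context (PD : forall f g, P f -> P g -> P (fun z => f z + g z)).
Context (PM : forall f g, P f -> P g -> P (fun z => f z * g z)).

Lemma complexwise_opp_real f : P f -> P (fun z => - f z).
Proof.
move=> Pf; have -> : (fun z => - f z) = (fun z => -1 * f z).
  by apply/funext => z; rewrite mulN1r.
exact: PM.
Qed.

Lemma complexwise_cst c : complexwise (fun=> c).
Proof. by split; exact: Pcst. Qed.

Lemma complexwise_real (f : V -> R) : P f -> complexwise (fun z => (f z)%:C).
Proof. by move=> sf; split=> //; exact: Pcst. Qed.

Lemma complexwiseN f : complexwise f -> complexwise (fun z => - f z).
Proof.
move=> [fr fi]; split.
- have -> : (fun z => complex.Re (- f z)) = (fun z => - complex.Re (f z)).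
    by apply/funext => z; case: (f z).
  exact: complexwise_opp_real.
- have -> : (fun z => complex.Im (- f z)) = (fun z => - complex.Im (f z)).
    by apply/funext => z; case: (f z).
  exact: complexwise_opp_real.
Qed.

Lemma complexwise_conj f : complexwise f -> complexwise (fun z => (f z)^*).
Proof.
move=> [fr fi]; split.
- have -> : (fun z => complex.Re (f z)^*) = (fun z => complex.Re (f z)).
    by apply/funext => z; case: (f z).
  exact: fr.
- have -> : (fun z => complex.Im (f z)^*) = (fun z => - complex.Im (f z)).
    by apply/funext => z; case: (f z).
  exact: complexwise_opp_real.
Qed.

Lemma complexwiseD f g : complexwise f -> complexwise g ->
  complexwise (fun z => f z + g z).
Proof.
move=> [fr fi] [gr gi]; split.
- have -> : (fun z => complex.Re (f z + g z)) =
      (fun z => complex.Re (f z) + complex.Re (g z)).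
    by apply/funext => z; case: (f z) => ? ?; case: (g z).
  exact: PD.
- have -> : (fun z => complex.Im (f z + g z)) =
      (fun z => complex.Im (f z) + complex.Im (g z)).
    by apply/funext => z; case: (f z) => ? ?; case: (g z).
  exact: PD.
Qed.

Lemma complexwiseM f g : complexwise f -> complexwise g ->
  complexwise (fun z => f z * g z).
Proof.
move=> [fr fi] [gr gi]; split.
- under eq_fun do rewrite ReM.
  by apply: PD; [exact: PM|apply: complexwise_opp_real; exact: PM].
- under eq_fun do rewrite ImM.
  by apply: PD; exact: PM.
Qed.

End Complexwise.

Section ComplexSmooth.
Context {R : realType} {n : nat}.
Local Notation V := (Cn R n).
Local Notation smooth := (@smooth_on R n setT).
Local Open Scope complex_scope.
Implicit Types (f g : V -> R[i]).

Definition csmooth f := complexwise smooth f.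

Lemma csmooth_complex (f g : V -> R) : smooth f -> smooth g ->
  csmooth (fun z => f z +i* g z).
Proof. by []. Qed.

Lemma csmooth_cst c : csmooth (fun=> c).
Proof. exact: complexwise_cst (@smooth_cst R n) _. Qed.

Lemma csmooth_real (f : V -> R) : smooth f -> csmooth (fun z => (f z)%:C).
Proof. exact: complexwise_real (@smooth_cst R n) _. Qed.

Lemma csmoothN f : csmooth f -> csmooth (fun z => - f z).
Proof. exact: complexwiseN (@smooth_cst R n) (@smooth_mul R n) _. Qed.

Lemma csmooth_conj f : csmooth f -> csmooth (fun z => (f z)^*).
Proof. exact: complexwise_conj (@smooth_cst R n) (@smooth_mul R n) _. Qed.

Lemma csmoothD f g : csmooth f -> csmooth g -> csmooth (fun z => f z + g z).
Proof. exact: complexwiseD (@smooth_add R n) _ _. Qed.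

Lemma csmoothM f g : csmooth f -> csmooth g -> csmooth (fun z => f z * g z).
Proof.
exact: complexwiseM (@smooth_cst R n) (@smooth_add R n) (@smooth_mul R n) _ _.
Qed.

End ComplexSmooth.

Section ComplexDifferentiable.
Context {R : realType} {n : nat}.
Local Notation V := (Cn R n).
Local Open Scope complex_scope.
Context (z0 : V).
Implicit Types (f g : V -> R[i]).

Definition cdiff f := complexwise (fun h : V -> R => differentiable h z0) f.

Let diff_cst (c : R) : differentiable (fun=> c : R) z0.
Proof. exact: (differentiable_cst c). Qed.

Let diff_add (f g : V -> R) : differentiable f z0 -> differentiable g z0 ->
  differentiable (fun z => f z + g z) z0.
Proof. exact: differentiableD. Qed.

Let diff_mul (f g : V -> R) : differentiable f z0 -> differentiable g z0 ->
  differentiable (fun z => f z * g z) z0.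
Proof. exact: differentiableM. Qed.

Lemma csmooth_cdiff f : csmooth f -> cdiff f.
Proof. by move=> [sr si]; split; exact: smooth_differentiable. Qed.

Lemma cdiffN f : cdiff f -> cdiff (fun z => - f z).
Proof. exact: complexwiseN diff_cst diff_mul _. Qed.

Lemma cdiff_conj f : cdiff f -> cdiff (fun z => (f z)^*).
Proof. exact: complexwise_conj diff_cst diff_mul _. Qed.

Lemma cdiffD f g : cdiff f -> cdiff g -> cdiff (fun z => f z + g z).
Proof. exact: complexwiseD diff_add _ _. Qed.

Lemma cdiffM f g : cdiff f -> cdiff g -> cdiff (fun z => f z * g z).
Proof. exact: complexwiseM diff_cst diff_add diff_mul _ _. Qed.

Lemma cdiffB f g : cdiff f -> cdiff g -> cdiff (fun z => f z - g z).
Proof. by move=> cf cg; apply: cdiffD => //; apply: cdiffN. Qed.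

End ComplexDifferentiable.

(** * Weak Z(2) *)
Section WeakZ2.
Context {R : realType}.
Local Notation C := R[i].
Local Notation V := (Cn R 3).
Local Notation smooth := (@smooth_on R 3 setT).
Local Open Scope complex_scope.
Local Open Scope sesquilinear_scope.
Implicit Types (z v : V) (L : 'rV[C]_3).

(** The components of the complex gradient of [rho0]. *)
Definition d1 z : C := (x1 z * Fa z) -i* (y1 z * Fa z).
Definition d2 z : C := (Fx z / 2) -i* (Fy z / 2).
Definition d3 z : C := x3 z -i* (y3 z - 1).
Definition dcol z : 'cV[C]_3 := (row3 (d1 z) (d2 z) (d3 z))^T.

(** The tangential lifts of d/dz1 and d/dz2, multiplied by d3 so as to stay
    smooth where d3 vanishes. *)
Definition lift1 z : 'rV[C]_3 := row3 (d3 z) 0 (- d1 z).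
Definition lift2 z : 'rV[C]_3 := row3 0 (d3 z) (- d2 z).

Definition grad2 z : R := nsq (d1 z) + nsq (d2 z) + nsq (d3 z).
Definition lifted_trace z : R :=
  (nsq (d1 z) + nsq (d3 z)) + psi z * (nsq (d2 z) + nsq (d3 z)).

Definition lifted_psd z : 'M[C]_3 :=
  (lift1 z) ^t* *m lift1 z + (psi z)%:C *: ((lift2 z) ^t* *m lift2 z).

(** On the boundary this is P - Phi / (1 + tr Phi), P being the orthogonal
    projector on T and Phi = [lifted_psd]; dividing by 1 + tr Phi makes
    Phi <= P.  Adding the square of [rho0], which vanishes on the boundary, to
    |d|^2 keeps the denominator positive everywhere ([denom_gt0]), so that
    [Upsilon0] is smooth on C^3. *)
Definition Upsilon0 z : 'M[C]_3 :=
  1%:M - ((grad2 z + rho0 z ^+ 2)^-1)%:C *: (dcol z *m (dcol z) ^t* )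
  - ((1 + lifted_trace z)^-1)%:C *: lifted_psd z.

Lemma mul_dcol z L : (L *m dcol z) 0 0 =
  L 0 i1 * d1 z + L 0 i2 * d2 z + L 0 i3 * d3 z.
Proof. by rewrite mxE sum3 /dcol /row3 !mxE. Qed.

Lemma T10_rho0P z L : (L <= T10 rho0 z)%MS <-> L *m dcol z = 0.
Proof.
have E : (L *m dcol z) 0 0 =
    (drho0 (real_vec L) z / 2) -i* (drho0 (real_vecJ L) z / 2).
  rewrite mul_dcol /drho0.
  rewrite /(x1 (real_vec _)) /(y1 (real_vec _)) /(x2 (real_vec _)) /(y2 (real_vec _)).
  rewrite /(x3 (real_vec _)) /(y3 (real_vec _)).
  rewrite /(x1 (real_vecJ _)) /(y1 (real_vecJ _)) /(x2 (real_vecJ _)) /(y2 (real_vecJ _)).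
  rewrite /(x3 (real_vecJ _)) /(y3 (real_vecJ _)).
  rewrite /re_coord /im_coord !mxE /=.
  case: (L 0 i1) => a b; case: (L 0 i2) => c d; case: (L 0 i3) => e f /=.
  by apply/eqP; rewrite eq_complex /=; apply/andP; split; apply/eqP; field.
have half0 (x y : R) : x / 2 -i* (y / 2) = 0 <-> x = 0 /\ y = 0.
  split=> [/eqP|[-> ->]].
    rewrite eq_complex /= oppr_eq0 !mulf_eq0 invr_eq0 pnatr_eq0 !orbF.
    by case/andP => /eqP-> /eqP->.
  by rewrite mul0r oppr0.
have -> : (L <= T10 rho0 z)%MS <-> drho0 (real_vec L) z = 0 /\ drho0 (real_vecJ L) z = 0.
  have := T10P z L smooth_rho0.
  by rewrite (derive_rho0 z (real_vec L)) (derive_rho0 z (real_vecJ L)).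
split=> [/half0|/matrixP/(_ 0 0)]; first by rewrite -E => e; apply/matrixP => i j; rewrite !ord1 e mxE.
by rewrite E mxE => /half0.
Qed.

Lemma nsq_ge0 (c : C) : 0 <= nsq c.
Proof. by rewrite addr_ge0 ?sqr_ge0. Qed.

Lemma nsqE (c : C) : c * c^* = (nsq c)%:C.
Proof.
case: c => a b; apply/eqP; rewrite eq_complex /nsq /=.
by apply/andP; split; apply/eqP; ring.
Qed.

Lemma nsq_eq0 (c : C) : nsq c = 0 -> c = 0.
Proof.
case: c => a b /eqP; rewrite paddr_eq0 ?sqr_ge0// !sqrf_eq0 /=.
by case/andP => /eqP-> /eqP->.
Qed.

Lemma nsqN (c : C) : nsq (- c) = nsq c.
Proof. by case: c => a b; rewrite /nsq /= !sqrrN. Qed.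

Lemma nsq0 : nsq (0 : C) = 0.
Proof. by rewrite /nsq /= !expr0n addr0. Qed.

End WeakZ2.

Section WeakZ2Proof.
Context {R : realType}.
Local Notation C := R[i].
Local Notation V := (Cn R 3).
Local Notation smooth := (@smooth_on R 3 setT).
Local Open Scope complex_scope.
Local Open Scope sesquilinear_scope.
Implicit Types (z v : V) (L : 'rV[C]_3).

Lemma grad2_ge0 z : 0 <= grad2 z.
Proof. by rewrite /grad2 addr_ge0 ?nsq_ge0// addr_ge0 ?nsq_ge0. Qed.

Lemma lifted_trace_ge0 z : 0 <= lifted_trace z.
Proof.
rewrite /lifted_trace; apply: addr_ge0; first by rewrite addr_ge0 ?nsq_ge0.
by apply: mulr_ge0; [exact: psi_ge0|rewrite addr_ge0 ?nsq_ge0].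
Qed.

Lemma drho0_d z v : drho0 v z =
  2 * (complex.Re (d1 z) * x1 v - complex.Im (d1 z) * y1 v +
       (complex.Re (d2 z) * x2 v - complex.Im (d2 z) * y2 v) +
       (complex.Re (d3 z) * x3 v - complex.Im (d3 z) * y3 v)).
Proof. by rewrite /drho0 /d1 /d2 /d3 /=; field. Qed.

Lemma grad2_gt0 z : rho0 z = 0 -> 0 < grad2 z.
Proof.
move=> r0; rewrite lt_neqAle grad2_ge0 andbT eq_sym; apply/eqP => g0.
have := drho0_euler r0; rewrite drho0_d; move/eqP: g0.
rewrite /grad2 paddr_eq0 ?nsq_ge0//; last by rewrite addr_ge0 ?nsq_ge0.
rewrite paddr_eq0 ?nsq_ge0//; case/andP => /andP[/eqP/nsq_eq0-> /eqP/nsq_eq0->] /eqP/nsq_eq0->.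
by rewrite /= !mul0r !subr0 !addr0 mulr0 => /le_gtF; rewrite ltr0n.
Qed.

Lemma denom_gt0 z : 0 < grad2 z + rho0 z ^+ 2.
Proof.
have [r0|r0] := eqVneq (rho0 z) 0; first by rewrite ltr_wpDr ?sqr_ge0// grad2_gt0.
by rewrite ltr_wpDl ?grad2_ge0// exprn_even_gt0.
Qed.

(** Phi vanishes only if d3 = 0, d1 = 0 and psi |d2|^2 = 0.  Then d2 is not
    zero, so psi = 0 and z1 = z2 = 0; but there d3 = 0 means w = i, the centre of
    the domain. *)
Lemma lifted_trace_gt0 z : rho0 z = 0 -> 0 < lifted_trace z.
Proof.
move=> r0; rewrite lt_neqAle lifted_trace_ge0 andbT eq_sym; apply/eqP => /eqP l0.
have p0 := psi_ge0 z; have g0 := grad2_gt0 r0.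
move: l0; rewrite /lifted_trace paddr_eq0; last 2 first.
- by rewrite addr_ge0 ?nsq_ge0.
- by rewrite mulr_ge0// addr_ge0 ?nsq_ge0.
rewrite paddr_eq0 ?nsq_ge0// => /andP[/andP[/eqP n1 /eqP n3]].
have n2 : nsq (d2 z) != 0.
  by apply: contraTneq g0 => n2; rewrite /grad2 n1 n2 n3 !addr0 ltxx.
rewrite n3 addr0 mulf_eq0 (negPf n2) orbF /psi.
have a0 := sqn1_ge0 z.
have a4 : 0 <= 4 * sqn1 z by rewrite mulr_ge0.
rewrite paddr_eq0 ?sqr_ge0//; last by rewrite addr_ge0// sqr_ge0.
rewrite paddr_eq0 ?sqr_ge0//.
rewrite mulf_eq0 pnatr_eq0 /= !sqrf_eq0 => /andP[/andP[/eqP az /eqP yz] /eqP bz].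
move/nsq_eq0: n3 => /eqP; rewrite /d3 eq_complex /= oppr_eq0 => /andP[/eqP x30 /eqP y30].
have x20 : x2 z = 0.
  by move/eqP: bz; rewrite /sqn2 paddr_eq0 ?sqr_ge0// !sqrf_eq0 => /andP[/eqP].
move: r0; rewrite /rho0 /base_fun az bz x20 yz x30 y30 => /eqP.
rewrite (_ : _ + _ = -1); last by ring.
by rewrite oppr_eq0 oner_eq0.
Qed.

Lemma adjmxZ_real m p (k : R) (M : 'M[C]_(m, p)) :
  (k%:C *: M) ^t* = k%:C *: M ^t*.
Proof.
apply/matrixP => i j; rewrite !mxE rmorphM; congr (_ * _).
exact: conjc_real.
Qed.

Lemma adjmxD m p (M N : 'M[C]_(m, p)) : (M + N) ^t* = M ^t* + N ^t*.
Proof. by apply/matrixP => i j; rewrite !mxE rmorphD. Qed.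

Lemma adjmxN m p (M : 'M[C]_(m, p)) : (- M) ^t* = - M ^t*.
Proof. by apply/matrixP => i j; rewrite !mxE rmorphN. Qed.

Lemma adj_gram m p (M : 'M[C]_(m, p)) : (M ^t* *m M) ^t* = M ^t* *m M.
Proof. by rewrite adjmxM adjmxK. Qed.

Definition tangent_proj z : 'M[C]_3 :=
  1%:M - ((grad2 z)^-1)%:C *: (dcol z *m (dcol z) ^t* ).

Lemma adj_tangent_proj z : (tangent_proj z) ^t* = tangent_proj z.
Proof.
by rewrite /tangent_proj adjmxD adjmxN adjmxZ_real adjmxM adjmxK trmx1 map_mx1.
Qed.

Lemma adj_lifted_psd z : (lifted_psd z) ^t* = lifted_psd z.
Proof. by rewrite /lifted_psd adjmxD adjmxZ_real !adj_gram. Qed.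

Lemma Upsilon0E z : rho0 z = 0 ->
  Upsilon0 z = tangent_proj z - ((1 + lifted_trace z)^-1)%:C *: lifted_psd z.
Proof. by move=> r0; rewrite /Upsilon0 r0 expr0n addr0. Qed.

Lemma adj_Upsilon0 z : rho0 z = 0 -> (Upsilon0 z) ^t* = Upsilon0 z.
Proof.
by move=> /Upsilon0E ->; rewrite adjmxD adjmxN adjmxZ_real adj_tangent_proj adj_lifted_psd.
Qed.

Lemma dcol_norm z : (dcol z) ^t* *m dcol z = ((grad2 z)%:C)%:M.
Proof.
rewrite [LHS]mx11_scalar mul_dcol /dcol /row3 !mxE /= ![_^* * _]mulrC.
congr (_%:M).
have -> : d1 z * (d1 z)^* + d2 z * (d2 z)^* + d3 z * (d3 z)^* =
  (nsq (d1 z))%:C + (nsq (d2 z))%:C + (nsq (d3 z))%:C by rewrite -!nsqE.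
by rewrite -!rmorphD.
Qed.

Lemma lift1_dcol z : lift1 z *m dcol z = 0.
Proof.
apply/matrixP => i j; rewrite !ord1 mul_dcol /lift1 /row3 !mxE /=.
by rewrite mul0r addr0 mulNr [d1 z * _]mulrC subrr.
Qed.

Lemma lift2_dcol z : lift2 z *m dcol z = 0.
Proof.
apply/matrixP => i j; rewrite !ord1 mul_dcol /lift2 /row3 !mxE /=.
by rewrite mul0r add0r mulNr [d2 z * _]mulrC subrr.
Qed.

Lemma tangent_proj_dcol z : rho0 z = 0 -> tangent_proj z *m dcol z = 0.
Proof.
move=> /grad2_gt0 g0; rewrite /tangent_proj mulmxBl mul1mx -scalemxAl -mulmxA.
rewrite dcol_norm mul_mx_scalar scalerA -rmorphM mulVf ?gt_eqF//.
by rewrite scale1r subrr.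
Qed.

Lemma Upsilon0_dcol z : rho0 z = 0 -> Upsilon0 z *m dcol z = 0.
Proof.
move=> r0; rewrite Upsilon0E// mulmxBl tangent_proj_dcol// -scalemxAl /lifted_psd.
rewrite mulmxDl -scalemxAl -!mulmxA lift1_dcol lift2_dcol !mulmx0.
by rewrite scaler0 addr0 scaler0 subr0.
Qed.

Lemma mul_tangent_proj m (M : 'M[C]_(m, 3)) z :
  M *m dcol z = 0 -> M *m tangent_proj z = M.
Proof.
move=> M0; rewrite /tangent_proj mulmxBr mulmx1 -scalemxAr mulmxA M0 mul0mx.
by rewrite scaler0 subr0.
Qed.

Lemma lift_norm1 z : (lift1 z *m (lift1 z) ^t* ) 0 0 = (nsq (d1 z) + nsq (d3 z))%:C.
Proof.
rewrite mxE sum3 /lift1 /row3 !mxE /= !nsqE -!rmorphD nsqN nsq0 addr0.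
by rewrite addrC.
Qed.

Lemma lift_norm2 z : (lift2 z *m (lift2 z) ^t* ) 0 0 = (nsq (d2 z) + nsq (d3 z))%:C.
Proof.
rewrite mxE sum3 /lift2 /row3 !mxE /= !nsqE -!rmorphD nsqN nsq0 add0r.
by rewrite addrC.
Qed.

Lemma lifted_psd_form (t : 'cV[C]_3) z :
  (t ^t* *m lifted_psd z *m t) 0 0 =
  ((lift1 z *m t) ^t* *m (lift1 z *m t)) 0 0 +
  (psi z)%:C * ((lift2 z *m t) ^t* *m (lift2 z *m t)) 0 0.
Proof.
rewrite /lifted_psd mulmxDr mulmxDl -scalemxAr -scalemxAl.
rewrite [LHS]mxE [in X in _ + X = _]mxE.
by rewrite !adjmxM !mulmxA.
Qed.

Lemma gram_ge0 m (w : 'cV[C]_m) : 0 <= (w ^t* *m w) 0 0.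
Proof.
rewrite mxE; apply: sumr_ge0 => i _; rewrite !mxE mulrC.
by rewrite nsqE lecR nsq_ge0.
Qed.

Lemma tangent_proj_form (t : 'cV[C]_3) z : rho0 z = 0 ->
  (t ^t* *m tangent_proj z *m t) 0 0 =
  ((tangent_proj z *m t) ^t* *m (tangent_proj z *m t)) 0 0.
Proof.
move=> r0; rewrite adjmxM adj_tangent_proj !mulmxA.
rewrite -(mulmxA (t ^t* ) (tangent_proj z) (tangent_proj z)).
by rewrite (mul_tangent_proj (tangent_proj_dcol r0)).
Qed.

(** Apply the Cauchy-Schwarz inequality to each lift and to the tangential part
    of t. *)
Lemma lifted_psd_le (t : 'cV[C]_3) z : rho0 z = 0 ->
  ((1 + lifted_trace z)^-1)%:C * (t ^t* *m lifted_psd z *m t) 0 0 <=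
  (t ^t* *m tangent_proj z *m t) 0 0.
Proof.
move=> r0; rewrite tangent_proj_form//; set w := tangent_proj z *m t.
have lw (L : 'rV[C]_3) : L *m dcol z = 0 -> L *m t = L *m w.
  by move=> Ld; rewrite /w mulmxA mul_tangent_proj.
have c1 := cauchy_schwarz_mx (lift1 z) w; have c2 := cauchy_schwarz_mx (lift2 z) w.
rewrite lift_norm1 in c1; rewrite lift_norm2 in c2.
rewrite lifted_psd_form (lw _ (lift1_dcol z)) (lw _ (lift2_dcol z)).
have w0 := gram_ge0 w.
have psi0 : 0 <= (psi z)%:C :> C by rewrite lecR psi_ge0.
have D0 : 0 < 1 + lifted_trace z by rewrite ltr_wpDr ?lifted_trace_ge0.
apply: (@le_trans _ _ (((1 + lifted_trace z)^-1)%:C * ((lifted_trace z)%:C * (w ^t* *m w) 0 0))).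
  apply: ler_wpM2l; first by rewrite lecR invr_ge0 ltW.
  have -> : (lifted_trace z)%:C = (nsq (d1 z) + nsq (d3 z))%:C +
      (psi z)%:C * (nsq (d2 z) + nsq (d3 z))%:C by rewrite -rmorphM -rmorphD.
  rewrite mulrDl; apply: lerD; first exact: c1.
  by rewrite -mulrA; apply: ler_wpM2l psi0 _ _ c2.
rewrite mulrA -rmorphM ler_piMl// lecR.
by rewrite mulrC ler_pdivrMr// mul1r lerDr.
Qed.

Lemma form_subZ m (t : 'cV[C]_m) (P Q : 'M[C]_m) k :
  (t ^t* *m (P - k *: Q) *m t) 0 0 =
  (t ^t* *m P *m t) 0 0 - k * (t ^t* *m Q *m t) 0 0.
Proof.
rewrite mulmxBr mulmxBl -scalemxAr -scalemxAl.
by rewrite [LHS]mxE; congr (_ + _); rewrite [LHS]mxE; congr (- _); rewrite mxE.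
Qed.

Lemma Upsilon0_form (t : 'cV[C]_3) z : rho0 z = 0 ->
  0 <= (t ^t* *m Upsilon0 z *m t) 0 0 <= (t ^t* *m tangent_proj z *m t) 0 0.
Proof.
move=> r0.
have E : (t ^t* *m Upsilon0 z *m t) 0 0 = (t ^t* *m tangent_proj z *m t) 0 0 -
    ((1 + lifted_trace z)^-1)%:C * (t ^t* *m lifted_psd z *m t) 0 0.
  by rewrite (Upsilon0E r0); exact: form_subZ.
have sandwich (x p q : C) : x = p - q -> 0 <= q -> q <= p -> 0 <= x <= p.
  by move=> -> q0 qp; rewrite subr_ge0 qp lerBlDr lerDl.
apply: sandwich E _ (lifted_psd_le t r0); apply: mulr_ge0.
  by rewrite lecR invr_ge0 addr_ge0 ?lifted_trace_ge0.
rewrite lifted_psd_form; apply: addr_ge0; first exact: gram_ge0.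
by apply: mulr_ge0; [rewrite lecR psi_ge0|exact: gram_ge0].
Qed.

Lemma trace_lifted_psd z : \tr (lifted_psd z) = (lifted_trace z)%:C.
Proof.
rewrite /lifted_psd mxtraceD mxtraceZ (mxtrace_mulC ((lift1 z) ^t* )).
rewrite (mxtrace_mulC ((lift2 z) ^t* )) !trace_mx11 lift_norm1 lift_norm2.
by rewrite -rmorphM -rmorphD.
Qed.

Lemma trace_tangent_proj z : rho0 z = 0 -> \tr (tangent_proj z) = 2.
Proof.
move=> /grad2_gt0 g0; rewrite /tangent_proj raddfB /= mxtrace1 mxtraceZ.
rewrite (mxtrace_mulC (dcol z)) dcol_norm mxtrace_scalar mulr1n -rmorphM.
rewrite mulVf ?gt_eqF// rmorph1.
by rewrite -(natr1 2) addrK.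
Qed.

Lemma trace_Upsilon0_neq2 z : rho0 z = 0 -> \tr (Upsilon0 z) != 2.
Proof.
move=> r0; rewrite (Upsilon0E r0) raddfB /= mxtraceZ trace_lifted_psd (trace_tangent_proj r0).
rewrite -subr_eq0 addrAC subrr sub0r oppr_eq0 -rmorphM.
rewrite fmorph_eq0 mulf_eq0 invr_eq0 !gt_eqF ?lifted_trace_gt0//.
by rewrite ltr_wpDr ?lifted_trace_ge0.
Qed.

Lemma leviQ_lift1 z : leviQ z (lift1 z) = H11 z * nsq (d3 z) + nsq (d1 z).
Proof.
rewrite /leviQ /lift1 /row3 !mxE /= nsqN nsq0 /cross /=.
by rewrite !(mulr0, subr0, addr0).
Qed.

Lemma leviQ_lift2 z : leviQ z (lift2 z) = H22 z * nsq (d3 z) + nsq (d2 z).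
Proof.
rewrite /leviQ /lift2 /row3 !mxE /= nsqN nsq0 /cross /=.
by rewrite !(mulr0, mul0r, subr0, addr0, add0r).
Qed.

(** On the lifts the Levi form is |d3|^2 times the Hessian of F, plus a square,
    so the cross term of the Hessian does not enter. *)
Lemma leviQ_lifts_ge0 z :
  0 <= leviQ z (lift1 z) + psi z * leviQ z (lift2 z).
Proof.
rewrite leviQ_lift1 leviQ_lift2.
have -> : H11 z * nsq (d3 z) + nsq (d1 z) + psi z * (H22 z * nsq (d3 z) + nsq (d2 z))
  = (H11 z + psi z * H22 z) * nsq (d3 z) + (nsq (d1 z) + psi z * nsq (d2 z)) by ring.
apply: addr_ge0; first by rewrite mulr_ge0 ?weighted_levi_ge0 ?nsq_ge0.
by apply: addr_ge0; [exact: nsq_ge0|rewrite mulr_ge0 ?psi_ge0 ?nsq_ge0].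
Qed.

Lemma csmooth_row3 (a b c : V -> C) : csmooth a -> csmooth b -> csmooth c ->
  forall j, csmooth (fun z => (row3 (a z) (b z) (c z)) 0 j).
Proof.
move=> sa sb sc; apply: ord3_ind.
- by have -> : (fun z => (row3 (a z) (b z) (c z)) 0 i1) = a by apply/funext => z; rewrite mxE.
- by have -> : (fun z => (row3 (a z) (b z) (c z)) 0 i2) = b by apply/funext => z; rewrite mxE.
- by have -> : (fun z => (row3 (a z) (b z) (c z)) 0 i3) = c by apply/funext => z; rewrite mxE.
Qed.

Ltac smooth_model :=
  rewrite /Fa /Fx /Fy /psi /sqn1 /sqn2 /x1 /y1 /x2 /y2 /x3 /y3; smooth_poly.

Lemma csmooth_d1 : csmooth (@d1 R).
Proof. by apply: csmooth_complex; smooth_model. Qed.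

Lemma csmooth_d2 : csmooth (@d2 R).
Proof. by apply: csmooth_complex; smooth_model. Qed.

Lemma csmooth_d3 : csmooth (@d3 R).
Proof. by apply: csmooth_complex; smooth_model. Qed.

Lemma smooth_nsq (f : V -> C) : csmooth f -> smooth (fun z => nsq (f z)).
Proof. by move=> [sr si]; apply: smooth_add; apply: smooth_exp. Qed.

Lemma smooth_psi : smooth (@psi R).
Proof. by smooth_model. Qed.

Lemma csmooth_Upsilon0 i j : csmooth (fun z => Upsilon0 z i j).
Proof.
have s1 := csmooth_d1; have s2 := csmooth_d2; have s3 := csmooth_d3.
have n1 := smooth_nsq s1; have n2 := smooth_nsq s2; have n3 := smooth_nsq s3.
have -> : (fun z => Upsilon0 z i j) = (fun z => (i == j)%:R
  - ((grad2 z + rho0 z ^+ 2)^-1)%:C *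
    (row3 (d1 z) (d2 z) (d3 z) 0 i * (row3 (d1 z) (d2 z) (d3 z) 0 j)^* )
  - ((1 + lifted_trace z)^-1)%:C *
    (((row3 (d3 z) 0 (- d1 z)) 0 i)^* * (row3 (d3 z) 0 (- d1 z)) 0 j +
     (psi z)%:C * (((row3 0 (d3 z) (- d2 z)) 0 i)^* * (row3 0 (d3 z) (- d2 z)) 0 j))).
  apply/funext => z; rewrite /Upsilon0 /lifted_psd /lift1 /lift2 /dcol.
  rewrite ![in LHS]mxE !big_ord1.
  by rewrite !(@mxE _ _ _ map_mx_key) !(@mxE _ _ _ trmx_key).
have sg : smooth (fun z => (grad2 z + rho0 z ^+ 2)^-1).
  apply: smooth_inv => [z|]; first by rewrite gt_eqF ?denom_gt0.
  apply: smooth_add; last exact/smooth_exp/smooth_rho0.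
  by apply: smooth_add => //; apply: smooth_add.
have sl : smooth (fun z => (1 + lifted_trace z)^-1).
  apply: smooth_inv => [z|]; first by rewrite gt_eqF// ltr_wpDr ?lifted_trace_ge0.
  apply: smooth_add; first exact: smooth_cst.
  apply: smooth_add; first exact: smooth_add.
  by apply: smooth_mul; [exact: smooth_psi|apply: smooth_add].
have c0 := @csmooth_cst R 3 0.
have r1 := csmooth_row3 s1 s2 s3.
have r2 := csmooth_row3 s3 c0 (csmoothN s1).
have r3 := csmooth_row3 c0 s3 (csmoothN s2).
apply: csmoothD; first apply: csmoothD; first exact: csmooth_cst.
- apply: csmoothN; apply: csmoothM; first exact: csmooth_real.
  by apply: csmoothM; [exact: r1|apply: csmooth_conj; exact: r1].
- apply: csmoothN; apply: csmoothM; first exact: csmooth_real.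
  apply: csmoothD.
    by apply: csmoothM; [apply: csmooth_conj; exact: r2|exact: r2].
  apply: csmoothM; first exact/csmooth_real/smooth_psi.
  by apply: csmoothM; [apply: csmooth_conj; exact: r3|exact: r3].
Qed.

End WeakZ2Proof.

Section WeakZ2Theorem.
Context {R : realType}.
Local Notation C := R[i].
Local Notation V := (Cn R 3).
Local Open Scope complex_scope.
Local Open Scope sesquilinear_scope.

Lemma Re_real (k : R) (c : C) : complex.Re (k%:C * c) = k * complex.Re c.
Proof. by rewrite ReM /= mul0r subr0. Qed.

Lemma ReD (a b : C) : complex.Re (a + b) = complex.Re a + complex.Re b.
Proof. by case: a => ? ?; case: b. Qed.

Lemma trace_rank1 (L : 'rV[C]_3) (A : 'M[C]_3) :
  \tr (L ^t* *m L *m A) = (L *m A *m L ^t* ) 0 0.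
Proof. by rewrite -mulmxA mxtrace_mulC trace_mx11. Qed.

Lemma Re_trace_subZ m (P Q A : 'M[C]_m) k :
  complex.Re (\tr ((P - k%:C *: Q) *m A)) =
  complex.Re (\tr (P *m A)) - k * complex.Re (\tr (Q *m A)).
Proof.
rewrite mulmxBl raddfB /= -scalemxAl mxtraceZ -Re_real.
by case: (\tr (P *m A)) => ? ?; case: (_ * _).
Qed.

Lemma trace_lifted_psd_mul z (A : 'M[C]_3) :
  complex.Re (\tr (lifted_psd z *m A)) =
  complex.Re ((lift1 z *m A *m (lift1 z) ^t* ) 0 0) +
  psi z * complex.Re ((lift2 z *m A *m (lift2 z) ^t* ) 0 0).
Proof.
rewrite /lifted_psd mulmxDl mxtraceD -scalemxAl mxtraceZ !trace_rank1.
by rewrite ReD Re_real.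
Qed.

Lemma weakly_Z_Omega0 rho : defining_function (@Omega0 R) rho ->
  weakly_Z 2 Omega0 rho euclidean_metric.
Proof.
move=> D1; split=> //; exists Upsilon0; split.
  split=> [z0 _|z bz].
    exists setT, Upsilon0; split; [exact: openT|by []| |by []].
    by move=> i j; exact: csmooth_Upsilon0.
  have r0 := (boundary_Omega0 z).1 bz.
  split; first by apply/hermsymmxP; rewrite (adj_Upsilon0 r0).
  have [h h0 [TT _]] := levi_proportional defining_rho0 D1 bz.
  apply/row_subP => i; rewrite TT; apply/T10_rho0P.
  by rewrite -row_mul (Upsilon0_dcol r0) row0.
move=> z bz; have r0 := (boundary_Omega0 z).1 bz.
have [h h0 [TT LL]] := levi_proportional defining_rho0 D1 bz.
(* the Gram projector that enters the dual norm and the trace is the explicit one *)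
have PB : let B := row_base (T10 rho z) in
    B ^t* *m invmx (B *m B ^t* ) *m B = tangent_proj z.
  apply: orthogonal_projector; first exact: adj_tangent_proj.
    apply/row_subP => i; rewrite TT; apply/T10_rho0P.
    by rewrite -row_mul (tangent_proj_dcol r0) row0.
  apply: mul_tangent_proj; apply/row_matrixP => i; rewrite row_mul row0.
  apply/T10_rho0P; rewrite -TT; apply: submx_trans (row_sub _ _) _.
  by rewrite eq_row_base.
split.
- move=> t.
  have -> : pairing (theta_form t) (Upsilon0 z) = (t ^t* *m Upsilon0 z *m t) 0 0.
    by rewrite pairingE /theta_form mulmxA mxtrace_mulC trace_mx11 mulmxA.
  have -> : dual_norm2 (euclidean_metric z) (T10 rho z) t =
      (t ^t* *m tangent_proj z *m t) 0 0.
    by rewrite /dual_norm2 /euclidean_metric mulmx1 adjmxM -PB !mulmxA.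
  exact: Upsilon0_form.
- rewrite /levi_eigenvalues sum_eigenvalues2; last exact: rank_T10 D1 bz.
  have -> : \tr (rel_mx (euclidean_metric z) (levi_mx rho z) (T10 rho z)) =
      \tr (tangent_proj z *m levi_mx rho z).
    rewrite /rel_mx /euclidean_metric mulmx1 -PB /=; move: (row_base _) => B.
    by rewrite -(mulmxA (B ^t* *m invmx (B *m B ^t* )) B) [RHS]mxtrace_mulC !mulmxA.
  have -> : complex.Re (pairing (levi_mx rho z) (Upsilon0 z)) =
      complex.Re (\tr (tangent_proj z *m levi_mx rho z)) -
      (1 + lifted_trace z)^-1 * complex.Re (\tr (lifted_psd z *m levi_mx rho z)).
    by rewrite pairingE (Upsilon0E r0); exact: Re_trace_subZ.
  rewrite subKr trace_lifted_psd_mul.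
  have T1 : (lift1 z <= T10 rho0 z)%MS by apply/T10_rho0P; exact: lift1_dcol.
  have T2 : (lift2 z <= T10 rho0 z)%MS by apply/T10_rho0P; exact: lift2_dcol.
  rewrite (LL _ T1) (LL _ T2) !levi_rho0.
  apply: mulr_ge0; first by rewrite invr_ge0 addr_ge0 ?lifted_trace_ge0.
  have -> : h * leviQ z (lift1 z) + psi z * (h * leviQ z (lift2 z)) =
    h * (leviQ z (lift1 z) + psi z * leviQ z (lift2 z)) by ring.
  by rewrite mulr_ge0 ?(ltW h0) ?leviQ_lifts_ge0.
- by rewrite pairingE /euclidean_metric mulmx1 trace_Upsilon0_neq2.
Qed.

End WeakZ2Theorem.

(** * Orthogonal bases of the tangent space *)
Section AdaptedBasis.
Context {R : realType}.
Local Notation C := R[i].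
Local Notation V := (Cn R 3).
Local Open Scope complex_scope.
Local Open Scope sesquilinear_scope.
Implicit Types (z : V) (u v : 'rV[C]_3) (a b : 'cV[C]_3).

Definition cross3 a b : 'rV[C]_3 :=
  row3 (a i2 0 * b i3 0 - a i3 0 * b i2 0)
       (a i3 0 * b i1 0 - a i1 0 * b i3 0)
       (a i1 0 * b i2 0 - a i2 0 * b i1 0).

Lemma cross3_orthl a b : cross3 a b *m a = 0.
Proof.
apply/matrixP => i j; rewrite !ord1 mxE sum3 /cross3 /row3 !mxE /=; ring.
Qed.

Lemma cross3_orthr a b : cross3 a b *m b = 0.
Proof.
apply/matrixP => i j; rewrite !ord1 mxE sum3 /cross3 /row3 !mxE /=; ring.
Qed.

(** If the cross product vanishes then a and b are proportional, and u kills
    both or none. *)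
Lemma cross3_neq0 a b u : a != 0 -> u *m a = 0 -> u *m b != 0 -> cross3 a b != 0.
Proof.
move=> a0 ua ub; apply: contraNneq ub => ab0.
have ab i j : a i 0 * b j 0 = a j 0 * b i 0.
  have c1 : a i2 0 * b i3 0 = a i3 0 * b i2 0.
    by apply/subr0_eq; have /rowP/(_ i1) := ab0; rewrite !mxE.
  have c2 : a i3 0 * b i1 0 = a i1 0 * b i3 0.
    by apply/subr0_eq; have /rowP/(_ i2) := ab0; rewrite !mxE.
  have c3 : a i1 0 * b i2 0 = a i2 0 * b i1 0.
    by apply/subr0_eq; have /rowP/(_ i3) := ab0; rewrite !mxE.
  by move: i; apply: ord3_ind; move: j; apply: ord3_ind.
have [i ai] : exists i, a i 0 != 0.
  apply/existsP; rewrite -negb_forall; apply: contraNN a0 => /forallP az.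
  by apply/eqP/matrixP => i j; rewrite ord1 mxE; apply/eqP; rewrite -[_ == _]negbK az.
apply/eqP/matrixP => k l; rewrite !ord1 [RHS]mxE; apply: (mulfI ai); rewrite mulr0.
rewrite mxE mulr_sumr.
transitivity (\sum_j u 0 j * a j 0 * b i 0).
  by apply: eq_bigr => j _; rewrite mulrCA ab mulrA.
rewrite -mulr_suml; have /matrixP/(_ 0 0) := ua; rewrite mxE => ->.
by rewrite mxE mul0r.
Qed.

Lemma Re_div_gt0 (x y : C) : 0 < y ->
  complex.Re (x / y) = complex.Re x / complex.Re y /\ 0 < complex.Re y.
Proof.
case: y => c d; rewrite ltcE /= => /andP[/eqP d0 c0]; subst d; split=> //.
have c0' : c != 0 by rewrite gt_eqF.
have e : x / (c%:C) * c%:C = x by rewrite divfK// fmorph_eq0.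
have := congr1 (@complex.Re R) e; rewrite mulrC Re_real => <-.
by rewrite [RHS]mulrC mulKf.
Qed.

Definition gnorm (G : 'M[C]_3) u : R := complex.Re ((u *m G *m u ^t* ) 0 0).

Lemma gnorm_gt0 G u : posdef G -> u != 0 -> 0 < gnorm G u.
Proof. by move=> [_ Gp] /Gp/(Re_div_gt0 0)[]. Qed.

(** The vector of T orthogonal to the tangent vector u for the metric G, as a
    polynomial in the data: it is as smooth as G and u. *)
Definition orth_vec z (G : 'M[C]_3) u : 'rV[C]_3 := cross3 (dcol z) (G *m u ^t* ).

Lemma dcol_neq0 z : rho0 z = 0 -> dcol z != 0.
Proof.
move=> /grad2_gt0; apply: contraTneq => d0.
have /matrixP/(_ 0 0) := dcol_norm z; rewrite d0 mulmx0 !mxE eqxx mulr1n => /eqP.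
by rewrite eq_sym fmorph_eq0 => /eqP->; rewrite ltxx.
Qed.

Lemma orth_vec_neq0 z G u : rho0 z = 0 -> posdef G -> u != 0 ->
  u *m dcol z = 0 -> orth_vec z G u != 0.
Proof.
move=> r0 [_ Gp] u0 ud; apply: cross3_neq0 ud _; first exact: dcol_neq0.
apply: contraTneq (Gp _ u0) => e.
by rewrite -mulmxA e mxE ltxx.
Qed.

Lemma orth_vec_orth z G u : posdef G -> (u *m G *m (orth_vec z G u) ^t* ) 0 0 = 0.
Proof.
move=> [/hermsymmxP GH _].
have e : u *m G = (G *m u ^t* ) ^t* by rewrite adjmxM adjmxK -GH.
by rewrite e -adjmxM cross3_orthr trmx0 map_mx0 mxE.
Qed.

(** For any defining function the traces occurring in 1-pseudoconvexity are, up
    to one positive factor h, the Rayleigh quotients of [leviQ] in the basis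
    u, [orth_vec z G u] of T. *)
Lemma levi_trace_model rho z : defining_function Omega0 rho ->
  boundary Omega0 z -> exists2 h, 0 < h &
  (forall u, u *m dcol z = 0 -> (u <= T10 rho z)%MS) /\
  (forall u, (u <= T10 rho z)%MS -> u *m dcol z = 0) /\
  (forall G m (E : 'M[C]_(m, 3)) u, posdef G -> u != 0 -> u *m dcol z = 0 ->
    (u :=: E)%MS ->
    complex.Re (\tr (rel_mx G (levi_mx rho z) E)) = h * (leviQ z u / gnorm G u)) /\
  forall G u, posdef G -> u != 0 -> u *m dcol z = 0 ->
    complex.Re (\tr (rel_mx G (levi_mx rho z) (T10 rho z))) =
    h * (leviQ z u / gnorm G u +
         leviQ z (orth_vec z G u) / gnorm G (orth_vec z G u)).
Proof.
move=> D1 bz; have r0 := (boundary_Omega0 z).1 bz.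
have [h h0 [TT LL]] := levi_proportional defining_rho0 D1 bz.
exists h; first exact: h0.
have inT u : u *m dcol z = 0 -> (u <= T10 rho z)%MS.
  by move=> ud; rewrite TT; apply/T10_rho0P.
have LQ u : u *m dcol z = 0 ->
    complex.Re ((u *m levi_mx rho z *m u ^t* ) 0 0) = h * leviQ z u.
  by move=> /T10_rho0P uT; rewrite (LL _ uT) levi_rho0.
have quot (G : 'M[C]_3) u : posdef G -> u != 0 -> u *m dcol z = 0 ->
    complex.Re ((u *m levi_mx rho z *m u ^t* ) 0 0 / (u *m G *m u ^t* ) 0 0) =
    h * (leviQ z u / gnorm G u).
  move=> [_ Gp] u0 ud; have [-> _] := Re_div_gt0 ((u *m levi_mx rho z *m u ^t* ) 0 0) (Gp _ u0).
  by rewrite (LQ _ ud) mulrA.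
split; first exact: inT.
split; first by move=> u; rewrite TT => /T10_rho0P.
split=> [G m E u Gp u0 ud uE|G u Gp u0 ud].
  by rewrite (rel_mx_trace1 _ Gp u0 uE) quot.
have vd := cross3_orthl (dcol z) (G *m u ^t* ).
have v0 := orth_vec_neq0 r0 Gp u0 ud.
rewrite (rel_mx_trace2 _ Gp u0 v0 (orth_vec_orth z u Gp) (inT _ ud) (inT _ vd));
  last exact: rank_T10 D1 bz.
by rewrite ReD (quot _ _ Gp u0 ud) (quot _ _ Gp v0 vd) -mulrDr.
Qed.

End AdaptedBasis.

(** * Boundary curves through the origin *)
Section TestFamily.
Context {R : realType} (al be x y : R).
Local Notation C := R[i].
Local Notation V := (Cn R 3).
Local Open Scope complex_scope.

Definition zeta : V := (row3 al x 0, row3 be y 0).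
(** The solution w = i * height of the equation of the boundary over the point
    s * (z1, z2); it is o(s), so the curve below has velocity [zeta] at 0. *)
Definition height (s : R) : R := 1 - Num.sqrt (1 - base_fun (s *: zeta)).
Definition test_curve (s : R) : V := s *: zeta + height s *: (0, row3 0 0 1).

Lemma test_curve_coord s : [/\ x1 (test_curve s) = s * al, y1 (test_curve s) = s * be,
  x2 (test_curve s) = s * x, y2 (test_curve s) = s * y & x3 (test_curve s) = 0 /\ y3 (test_curve s) = height s].
Proof.
by rewrite /test_curve; split; [..|split];
  rewrite /x1 /y1 /x2 /y2 /x3 /y3 /re_coord /im_coord /= !mxE /=; ring.
Qed.

Lemma scaled_coord s : [/\ x1 (s *: zeta) = s * al, y1 (s *: zeta) = s * be,
  x2 (s *: zeta) = s * x & y2 (s *: zeta) = s * y].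
Proof.
by split; rewrite /x1 /y1 /x2 /y2 /re_coord /im_coord /= !mxE /=.
Qed.

Lemma base_fun_test_curve s : base_fun (test_curve s) = base_fun (s *: zeta).
Proof.
have [e1 e2 e3 e4 _] := test_curve_coord s; have [f1 f2 f3 f4] := scaled_coord s.
by rewrite /base_fun /sqn1 /sqn2 e1 e2 e3 e4 f1 f2 f3 f4.
Qed.

Lemma derive_base_fun (z v : V) : is_derive z v base_fun
  (2 * (x1 z * x1 v + y1 z * y1 v) * Fa z + x2 v * Fx z + y2 v * Fy z).
Proof.
suff : has_deriv base_fun z v
  (2 * (x1 z * x1 v + y1 z * y1 v) * Fa z + x2 v * Fx z + y2 v * Fy z) by [].
rewrite /base_fun /sqn1 /sqn2 /x1 /y1 /x2 /y2.
apply: has_deriv_eq; first by derive_poly.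
rewrite /Fa /Fx /Fy /sqn1 /sqn2 /x1 /y1 /x2 /y2 /=; ring.
Qed.

Lemma base_fun0 : base_fun (0 *: zeta) = 0.
Proof.
have [f1 f2 f3 f4] := scaled_coord 0.
by rewrite /base_fun /sqn1 /sqn2 f1 f2 f3 f4; ring.
Qed.

Lemma smooth_base_fun : @smooth_on R 3 setT base_fun.
Proof.
rewrite /base_fun /sqn1 /sqn2 /x1 /y1 /x2 /y2.
smooth_poly.
Qed.

Lemma is_derive_base_scaled : is_derive (0 : R) 1 (fun s : R => base_fun (s *: zeta)) 0.
Proof.
have dbf := smooth_differentiable (0 *: zeta) smooth_base_fun.
have := is_derive_comp_curve dbf (is_derive_scaled zeta 0).
rewrite -deriveE//; have [_ ->] := derive_base_fun (0 *: zeta) zeta.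
have [f1 f2 f3 f4] := scaled_coord 0.
suff -> : 2 * (x1 (0 *: zeta) * x1 zeta + y1 (0 *: zeta) * y1 zeta) * Fa (0 *: zeta) +
  x2 zeta * Fx (0 *: zeta) + y2 zeta * Fy (0 *: zeta) = 0 by [].
rewrite /Fa /Fx /Fy /sqn1 /sqn2 f1 f2 f3 f4; ring.
Qed.

Lemma height0 : height 0 = 0.
Proof. by rewrite /height base_fun0 subr0 sqrtr1 subrr. Qed.

Lemma is_derive_height : is_derive (0 : R) 1 height 0.
Proof.
have d1 : is_derive (0 : R) 1 (fun s : R => 1 - base_fun (s *: zeta)) 0.
  have := is_deriveD (is_derive_cst (1 : R) (0 : R) (1 : R)) (is_deriveN is_derive_base_scaled).
  by rewrite oppr0 addr0.
have sq : is_derive (1 - base_fun (0 *: zeta)) 1 (@Num.sqrt R)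
    (2 * Num.sqrt (1 - base_fun (0 *: zeta)))^-1.
  by apply: is_derive1_sqrt; rewrite base_fun0 subr0.
have := @is_derive1_comp _ (@Num.sqrt R) (fun s : R => 1 - base_fun (s *: zeta)) 0 _ _ sq d1.
rewrite mulr0 => d2.
have := is_deriveD (is_derive_cst (1 : R) (0 : R) (1 : R)) (is_deriveN d2).
by rewrite oppr0 addr0.
Qed.

Lemma test_curve0 : test_curve 0 = 0.
Proof. by rewrite /test_curve height0 !scale0r addr0. Qed.

Lemma is_derive_test_curve : is_derive (0 : R) 1 test_curve zeta.
Proof.
have := is_deriveD (is_derive_scaled zeta 0)
  (is_derive_scalel (0, row3 0 0 1) is_derive_height).
by rewrite scale0r addr0.
Qed.

Lemma is_derive_along_test_curve (f : V -> R) : differentiable f 0 ->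
  is_derive (0 : R) 1 (f \o test_curve) ('D_zeta f 0).
Proof.
move=> df; have := @is_derive_comp_curve R 3 f test_curve 0 zeta.
by rewrite test_curve0 -(deriveE _ df); apply=> //; exact: is_derive_test_curve.
Qed.

Lemma cvg_along_test_curve (f : V -> R) : differentiable f 0 ->
  (fun s => f (test_curve s)) @ (0 : R)^'+ --> f 0.
Proof.
move=> /is_derive_along_test_curve[/derivable1_diffP/differentiable_continuous c0 _].
have -> : f 0 = (f \o test_curve) 0 by rewrite /comp test_curve0.
exact: cvg_at_right_filter c0.
Qed.

Lemma cvg_quotient_along_test_curve (f : V -> R) : differentiable f 0 -> f 0 = 0 ->
  (fun s => s^-1 * f (test_curve s)) @ (0 : R)^'+ --> 'D_zeta f 0.
Proof.
move=> df f0; have := cvg_quotient_right (is_derive_along_test_curve df).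
by under eq_fun do rewrite /= test_curve0 f0 subr0.
Qed.

Lemma cvg_test_curve : test_curve @ (0 : R)^'+ --> (0 : V).
Proof.
have [/derivable1_diffP/differentiable_continuous c0 _] := is_derive_test_curve.
by rewrite -test_curve0; exact: cvg_at_right_filter c0.
Qed.

Lemma near_test_curve (A : set V) : open A -> A 0 -> \forall s \near (0 : R)^'+, A (test_curve s).
Proof. by move=> oA A0; apply: cvg_test_curve; exact: open_nbhs_nbhs. Qed.

Lemma cvg_base_scaled : (fun s : R => base_fun (s *: zeta)) @ (0 : R)^'+ --> (0 : R).
Proof.
have [/derivable1_diffP/differentiable_continuous c0 _] := is_derive_base_scaled.
by rewrite -[X in _ --> X]base_fun0; exact: cvg_at_right_filter c0.
Qed.

Lemma near_base_lt1 : \forall s \near (0 : R)^'+, base_fun (s *: zeta) < 1.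
Proof. exact: (cvgr_lt _ cvg_base_scaled _ ltr01). Qed.

Lemma height_sqr s : base_fun (s *: zeta) < 1 ->
  (height s - 1) ^+ 2 = 1 - base_fun (s *: zeta).
Proof.
move=> f1; rewrite /height addrC addKr sqrrN sqr_sqrtr// subr_ge0; exact: ltW.
Qed.

Lemma rho0_test_curve s : base_fun (s *: zeta) < 1 -> rho0 (test_curve s) = 0.
Proof.
move=> f1; have [_ _ _ _ [e5 e6]] := test_curve_coord s.
by rewrite /rho0 e5 e6 base_fun_test_curve height_sqr//; ring.
Qed.

Let a := al ^+ 2 + be ^+ 2.
Let b := x ^+ 2 + y ^+ 2.

(** The Levi form on a tangential field along the curve, divided by s^3, as a
    polynomial in s, the first component p + i q, the second component
    s (c + i d) and m = |d3|^-2.  The third component has been eliminated by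
    tangency. *)
Definition third_form (s p q c d m : R) : R :=
  let phi := - 6 * x * a - 3 * x * y ^+ 2 + 3 * s * (a + b) ^+ 2 in
  let fx := 6 * x ^+ 2 - 3 * a * (a + y ^+ 2) * s ^+ 2 + 4 * b * x * s +
            6 * x * (a + b) ^+ 2 * s ^+ 3 in
  let fy := - 6 * x * a * y * s ^+ 2 + 4 * b * y * s + 6 * y * (a + b) ^+ 2 * s ^+ 3 in
  let kx := - 6 * a - 3 * y ^+ 2 + 12 * s * x * (a + b) in
  let ky := - 6 * x * y + 12 * s * y * (a + b) in
  let A := p * c + q * d in
  let B := q * c - p * d in
  (- 12 * x * a - 3 * x * y ^+ 2 + 3 * s * (a + b) * (3 * a + b)) * (p ^+ 2 + q ^+ 2) +
  (3 * x - 3 / 2 * (x * a) * s ^+ 2 + 4 * b * s + 3 * s ^+ 3 * (a + b) * (a + 3 * b)) *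
    (c ^+ 2 + d ^+ 2) +
  s * (kx * (al * A + be * B) - ky * (al * B - be * A)) +
  s ^+ 3 * ((s * phi * (al * p + be * q) + (fx * c + fy * d) / 2) ^+ 2 +
            (s * phi * (al * q - be * p) + (fx * d - fy * c) / 2) ^+ 2) * m.

Lemma nsq_d3_test_curve s : base_fun (s *: zeta) < 1 ->
  nsq (d3 (test_curve s)) = 1 - base_fun (s *: zeta).
Proof.
move=> f1; have [_ _ _ _ [e5 e6]] := test_curve_coord s.
by rewrite /nsq /d3 /= e5 e6 sqrrN height_sqr// expr0n add0r.
Qed.

Lemma leviQ_test_curve s (L : 'rV[C]_3) : s != 0 -> base_fun (s *: zeta) < 1 ->
  L *m dcol (test_curve s) = 0 ->
  leviQ (test_curve s) L = s ^+ 3 * third_form s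
    (complex.Re (L 0 i1)) (complex.Im (L 0 i1))
    (s^-1 * complex.Re (L 0 i2)) (s^-1 * complex.Im (L 0 i2))
    (1 - base_fun (s *: zeta))^-1.
Proof.
move=> s0 f1 Ld; have [e1 e2 e3 e4 [e5 e6]] := test_curve_coord s.
have m0 : 1 - base_fun (s *: zeta) != 0 by rewrite subr_eq0 eq_sym lt_eqF.
have n3 := nsq_d3_test_curve f1.
(* tangency gives d3 L3 = - (d1 L1 + d2 L2) *)
have N3 : nsq (L 0 i3) = nsq (L 0 i1 * d1 (test_curve s) + L 0 i2 * d2 (test_curve s)) *
    (1 - base_fun (s *: zeta))^-1.
  apply: (mulIf m0); rewrite mulfVK// -n3.
  have nsqM (u v : C) : nsq (u * v) = nsq u * nsq v.
    by case: u => ? ?; case: v => ? ?; rewrite /nsq /=; ring.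
  have /matrixP/(_ 0 0) := Ld; rewrite mul_dcol mxE => /eqP.
  by rewrite addr_eq0 => /eqP ->; rewrite nsqN nsqM.
rewrite /leviQ N3 /cross; move: (1 - base_fun (s *: zeta))^-1 => m.
case: (L 0 i1) => p q; case: (L 0 i2) => c d; clear Ld N3 n3 m0.
rewrite H11E H22E /nsq /d1 /d2 /Fa /Fx /Fy /Fax /Fay /sqn1 /sqn2 e1 e2 e3 e4 /=.
rewrite /third_form /a /b; by field.
Qed.

End TestFamily.

(** * Failure of 1-pseudoconvexity *)
Section Limits.
Context {R : realType} (al be x y : R).
Local Notation C := R[i].
Local Notation V := (Cn R 3).
Local Open Scope complex_scope.
Local Notation F := ((0 : R)^'+).
Local Notation curve := (test_curve al be x y).

Lemma limD (f g : R -> R) (k l : R) : f @ F --> k -> g @ F --> l ->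
  (fun s => f s + g s) @ F --> k + l.
Proof. exact: cvgD. Qed.

Lemma limN (f : R -> R) (k : R) : f @ F --> k -> (fun s => - f s) @ F --> - k.
Proof. exact: cvgN. Qed.

Lemma limM (f g : R -> R) (k l : R) : f @ F --> k -> g @ F --> l ->
  (fun s => f s * g s) @ F --> k * l.
Proof. exact: cvgM. Qed.

Lemma limX (f : R -> R) n (k : R) : f @ F --> k -> (fun s => f s ^+ n) @ F --> k ^+ n.
Proof.
move=> fk; elim: n => [|n IHn]; first exact: cvg_cst.
by under eq_fun do rewrite exprS; rewrite exprS; apply: limM.
Qed.

Lemma lim_cst (k : R) : (fun=> k : R) @ F --> k.
Proof. exact: cvg_cst. Qed.

Lemma lim_id : (fun s : R => s) @ F --> (0 : R).
Proof. by apply: cvg_at_right_filter; exact: cvg_id. Qed.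

Lemma lim_mull (k : R) : ( *%R k) @ F --> k * 0.
Proof. exact: (limM (@lim_cst k) lim_id). Qed.

Lemma cvg_third_form (p q c d m : R -> R) (p0 q0 c0 d0 m0 : R) :
  p @ F --> p0 -> q @ F --> q0 -> c @ F --> c0 -> d @ F --> d0 -> m @ F --> m0 ->
  (fun s => third_form al be x y s (p s) (q s) (c s) (d s) (m s)) @ F -->
  third_form al be x y 0 p0 q0 c0 d0 m0.
Proof.
move=> hp hq hc hd hm; rewrite /third_form.
repeat match goal with |- context [@fmap _ _ ?f _] =>
  lazymatch f with
  | (fun _ => ?c) => exact: lim_cst
  | (fun s => s) => exact: lim_id
  | (fun s => @?g s + @?h s) => apply: limD
  | (fun s => - @?g s) => apply: limN
  | (fun s => @?g s * @?h s) => apply: limM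
  | (fun s => @?g s ^+ ?n) => apply: limX
  | _ => first [exact: hp | exact: hq | exact: hc | exact: hd | exact: hm
               | exact: lim_mull]
  end
end.
Qed.

Lemma third_form0 p0 q0 c0 d0 m0 : third_form al be x y 0 p0 q0 c0 d0 m0 =
  3 * x * (c0 ^+ 2 + d0 ^+ 2 -
           (4 * (al ^+ 2 + be ^+ 2) + y ^+ 2) * (p0 ^+ 2 + q0 ^+ 2)).
Proof. by rewrite /third_form; field. Qed.

Lemma lim_ge0 (f : R -> R) (l : R) : f @ F --> l -> (\forall s \near F, 0 <= f s) -> 0 <= l.
Proof.
move=> fl f0; rewrite leNgt; apply/negP => l0.
have lt0 : \forall s \near F, f s < 0 by apply: (cvgr_lt l).
near F => s.
have h1 : 0 <= f s by near: s.
have h2 : f s < 0 by near: s.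
by rewrite ltNge h1 in h2.
Unshelve. all: by end_near. Qed.

Lemma cvg_inv_base :
  (fun s => (1 - base_fun (s *: zeta al be x y))^-1) @ F --> (1 : R).
Proof.
have : (fun s => 1 - base_fun (s *: zeta al be x y)) @ F --> (1 - 0 : R).
  by apply: limD; [exact: lim_cst|apply: limN; exact: cvg_base_scaled].
rewrite subr0 => h; rewrite -[X in _ --> X]invr1.
by apply: cvgV => //; exact: oner_neq0.
Qed.

Lemma leviQ_scale z (k : R) (L : 'rV[C]_3) :
  leviQ z (k%:C *: L) = k ^+ 2 * leviQ z L.
Proof.
rewrite /leviQ /cross /nsq !mxE.
case: (L 0 i1) => a b; case: (L 0 i2) => c d; case: (L 0 i3) => e f /=; ring.
Qed.

(** Since [leviQ] is quadratic, the first order behaviour on L is the third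
    order behaviour on s L, whose second component is s times that of L. *)
Lemma cvg_leviQ_first (L : R -> 'rV[C]_3) (p0 q0 c0 d0 : R) :
  (fun s => complex.Re (L s 0 i1)) @ F --> p0 ->
  (fun s => complex.Im (L s 0 i1)) @ F --> q0 ->
  (fun s => complex.Re (L s 0 i2)) @ F --> c0 ->
  (fun s => complex.Im (L s 0 i2)) @ F --> d0 ->
  (\forall s \near F, L s *m dcol (curve s) = 0) ->
  (fun s => s^-1 * leviQ (curve s) (L s)) @ F --> 3 * x * (c0 ^+ 2 + d0 ^+ 2).
Proof.
move=> hp hq hc hd hT.
have := cvg_third_form (limM lim_id hp) (limM lim_id hq) hc hd cvg_inv_base.
rewrite third_form0 !mul0r expr0n addr0 mulr0 subr0.
apply: cvg_trans; apply: near_eq_cvg; near=> s.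
have s0 : 0 < s by near: s; exact: nbhs_right_gt.
have sn0 : s != 0 by rewrite gt_eqF.
have f1 : base_fun (s *: zeta al be x y) < 1 by near: s; exact: near_base_lt1.
have Ld : L s *m dcol (curve s) = 0 by near: s.
have Ld' : (s%:C *: L s) *m dcol (curve s) = 0 by rewrite -scalemxAl Ld scaler0.
have := leviQ_test_curve sn0 f1 Ld'; rewrite leviQ_scale => E.
apply: (mulfI (expf_neq0 3 sn0)).
have -> : s ^+ 3 * (s^-1 * leviQ (curve s) (L s)) = s ^+ 2 * leviQ (curve s) (L s).
  by rewrite exprSr mulrA mulfK.
rewrite E; congr (_ * _).
have Zre (u : C) : complex.Re (s%:C * u) = s * complex.Re u.
  by case: u => ? ? /=; rewrite mul0r subr0.
have Zim (u : C) : complex.Im (s%:C * u) = s * complex.Im u.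
  by case: u => ? ? /=; rewrite mul0r addr0.
by rewrite !mxE !Zre !Zim !mulKf.
Unshelve. all: by end_near. Qed.

Lemma lim_leviQ_third (L : R -> 'rV[C]_3) (p0 q0 c1 e1 : R) :
  (fun s => complex.Re (L s 0 i1)) @ F --> p0 ->
  (fun s => complex.Im (L s 0 i1)) @ F --> q0 ->
  (fun s => s^-1 * complex.Re (L s 0 i2)) @ F --> c1 ->
  (fun s => s^-1 * complex.Im (L s 0 i2)) @ F --> e1 ->
  (\forall s \near F, L s *m dcol (curve s) = 0) ->
  (\forall s \near F, 0 <= leviQ (curve s) (L s)) ->
  0 <= 3 * x * (c1 ^+ 2 + e1 ^+ 2 -
     (4 * (al ^+ 2 + be ^+ 2) + y ^+ 2) * (p0 ^+ 2 + q0 ^+ 2)).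
Proof.
move=> hp hq hc hd hT hL.
rewrite -(third_form0 _ _ _ _ 1).
apply: lim_ge0 (cvg_third_form hp hq hc hd cvg_inv_base) _.
near=> s.
have s0 : 0 < s by near: s; exact: nbhs_right_gt.
have sn0 : s != 0 by rewrite gt_eqF.
have f1 : base_fun (s *: zeta al be x y) < 1 by near: s; exact: near_base_lt1.
have Ld : L s *m dcol (curve s) = 0 by near: s.
have L0 : 0 <= leviQ (curve s) (L s) by near: s.
by move: L0; rewrite (leviQ_test_curve sn0 f1 Ld) pmulr_rge0// exprn_gt0.
Unshelve. all: by end_near. Qed.

End Limits.

Section NoLineField.
Context {R : realType}.
Local Notation C := R[i].
Local Notation V := (Cn R 3).
Local Open Scope complex_scope.
Local Notation F := ((0 : R)^'+).

(** Taking al = be = y = 0 kills (r3, t3).  By polarization the vectors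
    (r1, t1), (r2, t2), (r4, t4) of the plane are then orthogonal and nonzero,
    which is one vector too many. *)
Lemma no_planar_orthogonal_triple (r1 r2 r3 r4 t1 t2 t3 t4 k : R) : 0 < k ->
  ~ (forall al be x y : R, x != 0 ->
    (al * r1 + be * r2 + x * r3 + y * r4) ^+ 2 +
    (al * t1 + be * t2 + x * t3 + y * t4) ^+ 2 =
    (4 * (al ^+ 2 + be ^+ 2) + y ^+ 2) * k).
Proof.
move=> k0 H.
have n1 := oner_neq0 R.
have : r3 ^+ 2 + t3 ^+ 2 == 0 by apply/eqP; have := H 0 0 1 0 n1; lra.
rewrite paddr_eq0 ?sqr_ge0// !sqrf_eq0 => /andP[/eqP r30 /eqP t30].
have H1 := H 1 0 1 0 n1; have H2 := H 0 1 1 0 n1; have H4 := H 0 0 1 1 n1.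
have H12 := H 1 1 1 0 n1; have H14 := H 1 0 1 1 n1; have H24 := H 0 1 1 1 n1.
rewrite r30 t30 in H1 H2 H4 H12 H14 H24; clear H.
have p1 : r1 ^+ 2 + t1 ^+ 2 = 4 * k by lra.
have p2 : r2 ^+ 2 + t2 ^+ 2 = 4 * k by lra.
have p4 : r4 ^+ 2 + t4 ^+ 2 = k by lra.
have o12 : r1 * r2 + t1 * t2 = 0 by lra.
have o14 : r1 * r4 + t1 * t4 = 0 by lra.
have o24 : r2 * r4 + t2 * t4 = 0 by lra.
have c0 : (r1 * t2 - t1 * r2) * (r1 * t4 - t1 * r4) = 0.
  transitivity ((r1 ^+ 2 + t1 ^+ 2) * (r2 * r4 + t2 * t4) -
    (r1 * r2 + t1 * t2) * (r1 * r4 + t1 * t4)); first by ring.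
  by rewrite o24 o12 mulr0 mul0r subr0.
have : (r1 ^+ 2 + t1 ^+ 2) * (r2 ^+ 2 + t2 ^+ 2) *
  ((r1 ^+ 2 + t1 ^+ 2) * (r4 ^+ 2 + t4 ^+ 2)) = 0.
  transitivity (((r1 * t2 - t1 * r2) ^+ 2 + (r1 * r2 + t1 * t2) ^+ 2) *
    ((r1 * t4 - t1 * r4) ^+ 2 + (r1 * r4 + t1 * t4) ^+ 2)); first by ring.
  by rewrite o12 o14 expr0n !addr0 -exprMn c0 expr0n.
by rewrite p1 p2 p4 => /eqP; rewrite gt_eqF// !mulr_gt0.
Qed.

Lemma zeta_basis (al be x y : R) : zeta al be x y =
  al *: zeta 1 0 0 0 + be *: zeta 0 1 0 0 + x *: zeta 0 0 1 0 + y *: zeta 0 0 0 1.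
Proof.
rewrite /zeta [RHS]surjective_pairing /=; congr pair; apply/rowP;
  apply: ord3_ind; rewrite !mxE /=; ring.
Qed.

Lemma derive_zeta (f : V -> R) al be x y : differentiable f 0 ->
  'D_(zeta al be x y) f 0 = al * 'D_(zeta 1 0 0 0) f 0 +
    be * 'D_(zeta 0 1 0 0) f 0 + x * 'D_(zeta 0 0 1 0) f 0 + y * 'D_(zeta 0 0 0 1) f 0.
Proof.
move=> df; rewrite zeta_basis !(deriveE _ df) !linearD.
by rewrite !scalar_linearZ.
Qed.

Lemma dcol0 : dcol (0 : V) i3 0 != 0.
Proof.
rewrite /dcol /row3 !mxE /= /d3 eq_complex /= negb_and; apply/orP; right.
by rewrite /y3 /im_coord mxE sub0r opprK oner_neq0.
Qed.

Lemma dcol0E (L : 'rV[C]_3) : L *m dcol (0 : V) = 0 -> L 0 i3 = 0.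
Proof.
have c1 : dcol (0 : V) i1 0 = 0.
  by rewrite /dcol /row3 !mxE /= /d1 /x1 /y1 /re_coord /im_coord !mxE !mul0r oppr0.
have c2 : dcol (0 : V) i2 0 = 0.
  rewrite /dcol /row3 !mxE /= /d2 /Fx /Fy /sqn1 /sqn2 /x1 /y1 /x2 /y2 /re_coord /im_coord !mxE.
  by apply/eqP; rewrite eq_complex /=; apply/andP; split; apply/eqP; field.
move=> /matrixP/(_ 0 0); rewrite mxE sum3 [RHS]mxE c1 c2 !mulr0 !add0r => /eqP.
by rewrite mulf_eq0 (negPf dcol0) orbF => /eqP.
Qed.

(** The inequality is used along the curves with directions zeta and - zeta: the
    third order term is odd, so it vanishes. *)
Lemma no_differentiable_nonneg_line (v : V -> 'rV[C]_3) :
  (forall j, cdiff 0 (fun z => v z 0 j)) -> v 0 != 0 -> v 0 *m dcol 0 = 0 ->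
  ~ (forall al be x y, \forall s \near F,
      v (test_curve al be x y s) *m dcol (test_curve al be x y s) = 0 /\
      0 <= leviQ (test_curve al be x y s) (v (test_curve al be x y s))).
Proof.
move=> dv v0 v0d H.
have [dr1 di1] := dv i1; have [dr2 di2] := dv i2.
have v3 := dcol0E v0d.
have near_tan al be x y : \forall s \near F, v (test_curve al be x y s) *m dcol (test_curve al be x y s) = 0.
  by apply: filterS (H al be x y) => s [].
have near_ge0 al be x y : \forall s \near F, 0 <= leviQ (test_curve al be x y s) (v (test_curve al be x y s)).
  by apply: filterS (H al be x y) => s [].
have v2 : v 0 0 i2 = 0.
  have := cvg_leviQ_first (cvg_along_test_curve 0 0 (-1) 0 dr1) (cvg_along_test_curve 0 0 (-1) 0 di1)
    (cvg_along_test_curve 0 0 (-1) 0 dr2) (cvg_along_test_curve 0 0 (-1) 0 di2) (near_tan 0 0 (-1) 0).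
  move=> /lim_ge0 ge0; apply: nsq_eq0; apply/eqP; rewrite eq_le nsq_ge0 andbT.
  have : 0 <= 3 * -1 * nsq (v 0 0 i2).
    apply: ge0; near=> s; apply: mulr_ge0.
      by rewrite invr_ge0 ltW//; near: s; exact: nbhs_right_gt.
    by near: s; exact: near_ge0.
  lra.
have k0 : 0 < nsq (v 0 0 i1).
  rewrite lt_neqAle nsq_ge0 andbT eq_sym; apply: contraNneq v0 => /nsq_eq0 v1.
  by apply/eqP/rowP; apply: ord3_ind; rewrite mxE.
have key al be x y : 0 <= 3 * x *
    (('D_(zeta al be x y) (fun z => complex.Re (v z 0 i2)) 0) ^+ 2 +
     ('D_(zeta al be x y) (fun z => complex.Im (v z 0 i2)) 0) ^+ 2 -
     (4 * (al ^+ 2 + be ^+ 2) + y ^+ 2) * nsq (v 0 0 i1)).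
  have re0 : complex.Re (v 0 0 i2) = 0 by rewrite v2.
  have im0 : complex.Im (v 0 0 i2) = 0 by rewrite v2.
  have q1 := @cvg_quotient_along_test_curve _ al be x y _ dr2 re0.
  have q2 := @cvg_quotient_along_test_curve _ al be x y _ di2 im0.
  exact: (@lim_leviQ_third _ _ _ _ _ (fun s => v (test_curve al be x y s)) _ _ _ _
    (cvg_along_test_curve al be x y dr1) (cvg_along_test_curve al be x y di1) q1 q2
    (near_tan al be x y) (near_ge0 al be x y)).
apply: (no_planar_orthogonal_triple k0) => al be x y x0.
have := key al be x y; have := key (- al) (- be) (- x) (- y).
rewrite (derive_zeta al be x y dr2) (derive_zeta al be x y di2).
rewrite (derive_zeta (- al) (- be) (- x) (- y) dr2) (derive_zeta (- al) (- be) (- x) (- y) di2).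
have alg (t X Y X' Y' c c' : R) : t != 0 -> X' = - X -> Y' = - Y -> c' = c ->
    0 <= 3 * - t * (X' ^+ 2 + Y' ^+ 2 - c') -> 0 <= 3 * t * (X ^+ 2 + Y ^+ 2 - c) ->
    X ^+ 2 + Y ^+ 2 = c.
  move=> t0 -> -> ->; rewrite !sqrrN => le1 le2; apply/eqP; rewrite -subr_eq0.
  have /eqP : t * (X ^+ 2 + Y ^+ 2 - c) = 0.
    move: (X ^+ 2 + Y ^+ 2 - c) le1 le2 => q le1 le2.
    by apply/eqP; rewrite eq_le; apply/andP; split; lra.
  by rewrite mulf_eq0 (negPf t0).
by apply: alg x0 _ _ _; rewrite ?mulNr ?sqrrN -?opprD.
Unshelve. all: by end_near. Qed.

End NoLineField.

Section NotOnePseudoconvex.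
Context {R : realType}.
Local Notation C := R[i].
Local Notation V := (Cn R 3).
Local Open Scope complex_scope.
Local Open Scope sesquilinear_scope.
Local Notation F := ((0 : R)^'+).

Lemma cdiff_dcol (z0 : V) j : cdiff z0 (fun z => dcol z j 0).
Proof.
have -> : (fun z : V => dcol z j 0) = fun z => row3 (d1 z) (d2 z) (d3 z) 0 j.
  by apply/funext => z; rewrite /dcol mxE.
apply: csmooth_cdiff; apply: csmooth_row3; [exact: csmooth_d1|exact: csmooth_d2|exact: csmooth_d3].
Qed.

Section AlongField.
Context (z0 : V) (G : V -> 'M[C]_3) (u : V -> 'rV[C]_3).
Context (dG : forall i j, cdiff z0 (fun z => G z i j)).
Context (du : forall j, cdiff z0 (fun z => u z 0 j)).

Lemma cdiff_mul_adj j : cdiff z0 (fun z => (G z *m (u z) ^t* ) j 0).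
Proof.
have -> : (fun z : V => (G z *m (u z) ^t* ) j 0) = fun z =>
    G z j i1 * (u z 0 i1)^* + G z j i2 * (u z 0 i2)^* + G z j i3 * (u z 0 i3)^*.
  by apply/funext => z; rewrite mxE sum3 !mxE.
by apply: cdiffD; [apply: cdiffD|]; apply: cdiffM => //; apply: cdiff_conj.
Qed.

Lemma cdiff_orth_vec j : cdiff z0 (fun z => orth_vec z (G z) (u z) 0 j).
Proof.
have dd k : cdiff z0 (fun z => dcol z k 0) by exact: cdiff_dcol.
have dg := cdiff_mul_adj.
have cr k l : cdiff z0 (fun z => dcol z k 0 * (G z *m (u z) ^t* ) l 0 -
    dcol z l 0 * (G z *m (u z) ^t* ) k 0).
  by apply: cdiffB; apply: cdiffM.
move: j; apply: ord3_ind.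
- have -> : (fun z : V => orth_vec z (G z) (u z) 0 i1) = fun z =>
    dcol z i2 0 * (G z *m (u z) ^t* ) i3 0 - dcol z i3 0 * (G z *m (u z) ^t* ) i2 0.
    by apply/funext => z; rewrite [LHS]mxE.
  exact: cr.
- have -> : (fun z : V => orth_vec z (G z) (u z) 0 i2) = fun z =>
    dcol z i3 0 * (G z *m (u z) ^t* ) i1 0 - dcol z i1 0 * (G z *m (u z) ^t* ) i3 0.
    by apply/funext => z; rewrite [LHS]mxE.
  exact: cr.
- have -> : (fun z : V => orth_vec z (G z) (u z) 0 i3) = fun z =>
    dcol z i1 0 * (G z *m (u z) ^t* ) i2 0 - dcol z i2 0 * (G z *m (u z) ^t* ) i1 0.
    by apply/funext => z; rewrite [LHS]mxE.
  exact: cr.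
Qed.

Lemma differentiable_gnorm : differentiable (fun z => gnorm (G z) (u z)) z0.
Proof.
have dg := cdiff_mul_adj.
suff [] : cdiff z0 (fun z => (u z *m G z *m (u z) ^t* ) 0 0) by [].
have -> : (fun z : V => (u z *m G z *m (u z) ^t* ) 0 0) = fun z =>
    u z 0 i1 * (G z *m (u z) ^t* ) i1 0 + u z 0 i2 * (G z *m (u z) ^t* ) i2 0 +
    u z 0 i3 * (G z *m (u z) ^t* ) i3 0.
  by apply/funext => z; rewrite -mulmxA mxE sum3.
by apply: cdiffD; [apply: cdiffD|]; apply: cdiffM.
Qed.

End AlongField.

Lemma cdiff_smooth_mx p q (W : set V) (M : V -> 'M[C]_(p, q)) z0 :
  smooth_mx_on W M -> W z0 -> forall i j, cdiff z0 (fun z => M z i j).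
Proof.
move=> sM Wz i j; have [sr si] := sM i j.
by split; [exact: (sr [::])|exact: (si [::])].
Qed.

Lemma cdiff_lift2 (z0 : V) j : cdiff z0 (fun z => lift2 z 0 j).
Proof.
apply: csmooth_cdiff; apply: csmooth_row3; first exact: csmooth_cst.
  exact: csmooth_d3.
exact: csmoothN csmooth_d2.
Qed.

Lemma lift2_neq0 (z : V) : d3 z != 0 -> lift2 z != 0.
Proof.
apply: contra_neq => l0; have /rowP/(_ i2) := l0.
by rewrite /lift2 /row3 !mxE.
Qed.

Lemma d3_test_curve_neq0 al be x y s : base_fun (s *: zeta al be x y) < 1 ->
  d3 (test_curve al be x y s) != 0 :> C.
Proof.
move=> f1; apply: contraTneq (f1) => d30; rewrite -leNgt.
have := nsq_d3_test_curve f1; rewrite d30 nsq0 => /esym/subr0_eq <-; exact: lexx.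
Qed.

(** Along the curve with z1 = 0 and z2 = - s the Levi form of a vector u is
    - 3 s |u_2|^2 + o(s), and [lift2] has u_2 = d3 <> 0 at 0. *)
Lemma no_nonneg_levi_trace (G : V -> 'M[C]_3) :
  (forall i j, cdiff 0 (fun z => G z i j)) -> posdef (G 0) ->
  ~ (\forall s \near F, let z := test_curve 0 0 (-1) 0 s in
      0 <= leviQ z (lift2 z) / gnorm (G z) (lift2 z) +
           leviQ z (orth_vec z (G z) (lift2 z)) /
             gnorm (G z) (orth_vec z (G z) (lift2 z))).
Proof.
move=> dG G0 H.
have du j : cdiff 0 (fun z : V => lift2 z 0 j) by exact: cdiff_lift2.
have dv j := cdiff_orth_vec dG du j.
have lim_quot (w : V -> 'rV[C]_3) : (forall j, cdiff 0 (fun z => w z 0 j)) ->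
    (forall z, w z *m dcol z = 0) -> w 0 != 0 ->
  (fun s => s^-1 * leviQ (test_curve 0 0 (-1) 0 s) (w (test_curve 0 0 (-1) 0 s)) *
     (gnorm (G (test_curve 0 0 (-1) 0 s)) (w (test_curve 0 0 (-1) 0 s)))^-1) @ F -->
  3 * -1 * nsq (w 0 0 i2) * (gnorm (G 0) (w 0))^-1.
  move=> dw wT w0; have [dr1 di1] := dw i1; have [dr2 di2] := dw i2.
  apply: limM.
    apply: (cvg_leviQ_first (cvg_along_test_curve 0 0 (-1) 0 dr1) (cvg_along_test_curve 0 0 (-1) 0 di1)
      (cvg_along_test_curve 0 0 (-1) 0 dr2) (cvg_along_test_curve 0 0 (-1) 0 di2)).
    by near=> s; exact: wT.
  apply: cvgV; first by rewrite gt_eqF// gnorm_gt0.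
  exact: (cvg_along_test_curve 0 0 (-1) 0 (differentiable_gnorm dG dw)).
have r00 := @rho00 R.
have d30 : d3 (0 : V) != 0.
  by have := @dcol0 R; rewrite /dcol /row3 !mxE.
have u0 := lift2_neq0 d30.
have ud := @lift2_dcol R 0.
have v0 := orth_vec_neq0 r00 G0 u0 ud.
have := limD (lim_quot _ du (@lift2_dcol R) u0)
  (lim_quot (fun z => orth_vec z (G z) (lift2 z)) dv
    (fun z => cross3_orthl (dcol z) (G z *m (lift2 z) ^t* )) v0).
move=> /lim_ge0 ge0.
have gu := gnorm_gt0 G0 u0; have gv := gnorm_gt0 G0 v0.
have : 0 <= 3 * -1 * nsq (lift2 (0 : V) 0 i2) / gnorm (G 0) (lift2 0) +
   3 * -1 * nsq (orth_vec 0 (G 0) (lift2 0) 0 i2) / gnorm (G 0) (orth_vec 0 (G 0) (lift2 0)).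
  apply: ge0; near=> s; have s0 : 0 < s by near: s; exact: nbhs_right_gt.
  rewrite -!mulrA -mulrDr mulr_ge0 ?invr_ge0 ?(ltW s0)//.
  by near: s; exact: H.
have n1 : 0 < nsq (lift2 (0 : V) 0 i2).
  rewrite lt_neqAle nsq_ge0 andbT eq_sym; apply: contra_neq d30 => /nsq_eq0.
  by rewrite /lift2 /row3 mxE.
have n2 := nsq_ge0 (orth_vec 0 (G 0) (lift2 0) 0 i2).
have alg (a b g k : R) : 0 < a -> 0 <= b -> 0 < g -> 0 < k ->
    0 <= 3 * -1 * a / g + 3 * -1 * b / k -> False.
  move=> a0 b0 g0 k0; have p : 0 < a / g by exact: divr_gt0.
  have q : 0 <= b / k by rewrite divr_ge0// ltW.
  have -> : 3 * -1 * a / g + 3 * -1 * b / k = - (3 * (a / g + b / k)) by ring.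
  by rewrite oppr_ge0 leNgt mulr_gt0// ltr_wpDr.
exact: alg n1 n2 gu gv.
Unshelve. all: by end_near. Qed.

(** With r = 0 the trace over the subbundle is 0 and the trace over T must be
    nonnegative; with r = 1 the trace over T minus that over the subbundle is the
    Rayleigh quotient of the orthogonal complement. *)
Lemma not_one_pseudoconvex (rho : V -> R) : defining_function Omega0 rho ->
  ~ exists (W : set V) (G : V -> 'M[C]_3),
    [/\ open W, W 0, hermitian_metric_on W G & one_pseudoconvex_at Omega0 rho W G 0].
Proof.
move=> D1 [W [G [oW W0 [sG Gpos] [U [r [E [[oU U0] UW r1 sE HE]]]]]]].
have b0 : boundary Omega0 (0 : V) by apply/boundary_Omega0; exact: rho00.
have [W1 [B [oW1 W10 sB EB]]] := sE 0 (conj U0 b0).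
have G0 : posdef (G 0) by exact: Gpos.
have dG := cdiff_smooth_mx sG W0.
have near_good al be x y : \forall s \near F,
    [/\ boundary Omega0 (test_curve al be x y s), U (test_curve al be x y s) & W1 (test_curve al be x y s)].
  near=> s; split.
  - by apply/boundary_Omega0/rho0_test_curve; near: s; exact: near_base_lt1.
  - by near: s; exact: near_test_curve.
  - by near: s; exact: near_test_curve.
have trace_ge z : U z -> boundary Omega0 z ->
    complex.Re (\tr (rel_mx (G z) (levi_mx rho z) (E z))) <=
    complex.Re (\tr (rel_mx (G z) (levi_mx rho z) (T10 rho z))).
  move=> Uz bz; have := HE z (conj Uz bz).
  by rewrite /levi_trace /levi_eigenvalues sum_eigenvalues2// (rank_T10 D1 bz).
case: r r1 B sE sB EB => [|[|//]] _ B _ sB EB.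
  apply: (no_nonneg_levi_trace dG G0); near=> s => /=.
  have [bz Uz W1z] : [/\ boundary Omega0 (test_curve 0 0 (-1) 0 s), U (test_curve 0 0 (-1) 0 s)
     & W1 (test_curve 0 0 (-1) 0 s)] by near: s; exact: near_good.
  have f1 : base_fun (s *: zeta 0 0 (-1) 0) < 1 :> R by near: s; exact: near_base_lt1.
  move: bz Uz W1z (d3_test_curve_neq0 f1); move: (test_curve 0 0 (-1) 0 s) => z bz Uz W1z d30.
  have [h h0 [_ [_ [_ tr2]]]] := levi_trace_model D1 bz.
  have [_ BE _] := EB z (conj W1z (conj Uz bz)).
  have rE : \rank (E z) = 0%N by rewrite -BE (flatmx0 (B z)) mxrank0.
  have := trace_ge z Uz bz; rewrite rel_mx_trace0// (tr2 _ _ (Gpos z (UW z Uz)) (lift2_neq0 d30) (lift2_dcol z)).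
  by rewrite pmulr_rge0.
have dB := cdiff_smooth_mx sB W10 0.
have model z : boundary Omega0 z -> U z -> W1 z ->
    [/\ B z != 0, B z *m dcol z = 0 & 0 <= leviQ z (orth_vec z (G z) (B z))].
  move=> bz Uz W1z.
  have [h h0 [_ [outT [tr1 tr2]]]] := levi_trace_model D1 bz.
  have [fB BE BT] := EB z (conj W1z (conj Uz bz)).
  have Gz : posdef (G z) := Gpos z (UW z Uz).
  have Bz0 : B z != 0 by rewrite -mxrank_eq0 (eqP fB).
  have Bd := outT _ BT.
  split=> //.
  have := trace_ge z Uz bz; rewrite (tr1 _ _ _ _ Gz Bz0 Bd BE) (tr2 _ _ Gz Bz0 Bd).
  rewrite (ler_pM2l h0) lerDl.
  by rewrite pmulr_lge0// invr_gt0 gnorm_gt0// orth_vec_neq0//; apply/boundary_Omega0.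
have [B0 Bd0 _] := model 0 b0 U0 W10.
apply: (@no_differentiable_nonneg_line _ (fun z => orth_vec z (G z) (B z))).
- exact: cdiff_orth_vec dG dB.
- exact: orth_vec_neq0 (@rho00 R) G0 B0 Bd0.
- exact: cross3_orthl.
move=> al be x y; near=> s; split; first exact: cross3_orthl.
have [bz Uz W1z] : [/\ boundary Omega0 (test_curve al be x y s), U (test_curve al be x y s)
     & W1 (test_curve al be x y s)] by near: s; exact: near_good.
by have [] := model _ bz Uz W1z.
Unshelve. all: by end_near. Qed.

End NotOnePseudoconvex.

Theorem proposition6p1 (R : realType) :
  exists Omega : set (Cn R 3),
    [/\ smooth_bounded_domain Omega,
        boundary Omega 0 &
        forall rho : Cn R 3 -> R, defining_function Omega rho ->
          (~ exists (W : set (Cn R 3)) (G : Cn R 3 -> 'M[R[i]]_3),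
               [/\ open W, W 0, hermitian_metric_on W G &
                   one_pseudoconvex_at Omega rho W G 0]) /\
          weakly_Z 2 Omega rho euclidean_metric].
Proof.
exists Omega0; split.
- exact: smooth_bounded_domain_Omega0.
- by apply/boundary_Omega0; exact: rho00.
move=> rho D1; split; first exact: not_one_pseudoconvex.
exact: weakly_Z_Omega0.
Qed.
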